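(* Let $a,b:\mathbb{Z}\to(0,+\infty)$ and suppose that there are constants $\kappa>0$ and $\mu\ge\nu>0$ such that $$a(j)+b(j)=\kappa,\qquad \nu\le a(j)\,b(j+1)\le\mu\qquad\text{for all }j\in\mathbb{Z}.$$ Let $\mathbf{P}^{00}$ be the law on $\mathscr{U}$ of the bridge, from and to $0$ on $[0,1]$, of the continuous-time random walk on $\mathbb{Z}$ which jumps from $j$ to $j+1$ at rate $a(j)$ and from $j$ to $j-1$ at rate $b(j)$, and let $P^{00}$ be the law on $\mathscr{U}$ of the bridge, from and to $0$ on $[0,1]$, of the continuous-time random walk on $\mathbb{Z}$ with unit jump rates up and down. Then $$d_{W,1}(\mathbf{P}^{00},P^{00})\le 9\left(\mu\cdot\frac{I_0(2\mu/\sqrt\nu)}{I_0(2\sqrt\nu)}-\sqrt{\mu\nu}+|1-\sqrt{\mu\nu}|\right),$$ where $I_0$ is the modified Bessel function of the first kind (of order $0$).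
   Context: The bridge of a walk with law $\mathbf{P}$ on $\mathbb{D}([0,1];\mathbb{Z})$ is $\mathbf{P}(\cdot\mid X_0=0,X_1=0)$. $\mathscr{U}$ is the set of pairs $U=(U^+,U^-)$ of finite disjoint subsets of $(0,1)$ with $|U^+|=|U^-|$. Piecewise constant càdlàg paths on $[0,1]$ from $0$ to $0$ with jumps $\pm1$ are in bijection with $\mathscr{U}$ by sending a path to ($U^+$ = set of times of $+1$ jumps, $U^-$ = set of times of $-1$ jumps). $\mathscr{U}$ carries the $\sigma$-algebra transported by this bijection, and bridge laws are identified with their push-forward to $\mathscr{U}$. Let $\mathscr{A}=(0,1)^2\setminus\{(u,u):u\in(0,1)\}$. For $(r,s)\in\mathscr{A}$ define $\Psi_{r,s}U=(U^+\cup\{r\},U^-\cup\{s\})$ if $r\notin U^+$, $s\notin U^-$; $\Psi_{r,s}U=(U^+\setminus\{r\},U^-\setminus\{s\})$ if $r\in U^+$, $s\in U^-$; and $\Psi_{r,s}U=U$ otherwise (also $\Psi_{r,s}U=U$ if the first rule would give a pair not in $\mathscr{U}$, i.e. if $r\in U^-$ or $s\in U^+$; for each $U$ this concerns only a Lebesgue-null set of $(r,s)$). $d$ is the graph distance on $\mathscr{U}$ for which $U\ne V$ are neighbours iff $U=\Psi_{r,s}V$ for some $(r,s)\in\mathscr{A}$. $\mathrm{Lip}_1(\mathscr{U})$ is the set of measurable $f:\mathscr{U}\to\mathbb{R}$ with $|f(U)-f(V)|\le d(U,V)$, and $d_{W,1}(\mu,\nu)=\sup\{|\int f\,d\mu-\int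 f\,d\nu|:f\in\mathrm{Lip}_1(\mathscr{U}),\ f\ \mu\text{- and }\nu\text{-integrable}\}$. *)

(* Defs.v *)
From HB Require Import structures.
From mathcomp Require Import all_boot all_order all_algebra.
From mathcomp Require Import finmap.
From mathcomp Require Import all_classical all_reals all_analysis.

Set Implicit Arguments.
Unset Strict Implicit.
Unset Printing Implicit Defensive.

Import Order.TTheory GRing.Theory Num.Theory.
Import numFieldNormedType.Exports.

Local Open Scope fset_scope.
Local Open Scope classical_set_scope.
Local Open Scope ring_scope.

(** * The path space D([0,1]; Z) *)

Definition I01 (R : realType) : Type := {t : R | 0 <= t <= 1}.

Definition I01_0 (R : realType) : I01 R :=
  exist (fun t : R => 0 <= t <= 1) 0 (introT andP (conj (lexx 0) ler01)).

Definition I01_1 (R : realType) : I01 R :=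
  exist (fun t : R => 0 <= t <= 1) 1 (introT andP (conj ler01 (lexx 1))).

(* Z is discrete, so one-sided limits are eventual constancy.  The first clause
   is void at t = 1 and the second one at t = 0. *)
Definition is_cadlag (R : realType) (x : I01 R -> int) : Prop :=
  forall t : I01 R,
    (exists2 e : R, 0 < e &
      forall s : I01 R, \val t <= \val s < \val t + e -> x s = x t) /\
    (exists k : int, exists2 e : R, 0 < e &
      forall s : I01 R, \val t - e < \val s < \val t -> x s = k).

Record cadlag (R : realType) : Type := Cadlag {
  cadlag_fun :> I01 R -> int ;
  cadlagP : is_cadlag cadlag_fun }.

Lemma is_cadlag0 (R : realType) : is_cadlag (fun _ : I01 R => 0).
Proof. by move=> t; split; [|exists 0]; exists 1. Qed.

HB.instance Definition _ (R : realType) := gen_eqMixin (cadlag R).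
HB.instance Definition _ (R : realType) := gen_choiceMixin (cadlag R).
HB.instance Definition _ (R : realType) :=
  isPointed.Build (cadlag R) (Cadlag (@is_cadlag0 R)).

(* The Borel sigma-algebra of the Skorokhod topology is the one generated by the
   evaluations. *)
Definition evaluation_events (R : realType) : set (set (cadlag R)) :=
  [set A | exists (t : I01 R) (k : int), A = [set x : cadlag R | x t = k]].

HB.instance Definition _ (R : realType) :=
  Measurable.copy (cadlag R) (g_sigma_algebraType (@evaluation_events R)).

(** * Continuous-time random walks and their bridges *)

Section walk.
Variable R : realType.
Implicit Types a b : int -> R.

(* Embedded jump chain: from i the walk jumps to i + 1 with probability
   a i / (a i + b i) and to i - 1 with probability b i / (a i + b i). *)
Definition jump_prob a b (i j : int) : R :=
  if j == i + 1 then a i / (a i + b i)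
  else if j == i - 1 then b i / (a i + b i)
  else 0.

(* Y is a Markov chain with transition matrix [jump_prob a b] and, given Y, the
   holding times S 0, S 1, ... are independent, S k being exponential of rate
   a (Y k) + b (Y k).  The initial law is arbitrary. *)
Definition jump_chain_holding_times a b d (Omega : measurableType d)
    (Pr : probability Omega R) (Y : nat -> Omega -> int)
    (S : nat -> Omega -> R) : Prop :=
  [/\ forall n j, measurable [set w | Y n w = j],
      forall n, measurable_fun [set: Omega] (S n) &
      forall (n : nat) (i : nat -> int) (s : nat -> R), (forall k, 0 <= s k) ->
        Pr [set w | forall k, (k <= n)%N -> Y k w = i k /\ (s k < S k w)%R] =
        (Pr [set w | Y 0%N w = i 0%N] *
         (\prod_(0 <= k < n) jump_prob a b (i k) (i k.+1) *
          \prod_(0 <= k < n.+1) expR (- ((a (i k) + b (i k)) * s k)))%:E)%E].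

(* P is the law, up to time 1, of the walk on Z which jumps from j to j + 1 at
   rate a j and from j to j - 1 at rate b j: it is the law of a process X that
   is equal to Y n between the n-th jump time S 0 + ... + S (n - 1) and the
   next one.  The values of X after an explosion are not constrained; there is
   almost surely none when a + b is bounded. *)
Definition walk_law a b (P : probability (cadlag R) R) : Prop :=
  exists (d : measure_display) (Omega : measurableType d)
         (Pr : probability Omega R)
         (Y : nat -> Omega -> int) (S : nat -> Omega -> R)
         (X : Omega -> cadlag R),
  [/\ jump_chain_holding_times a b Pr Y S,
      measurable_fun [set: Omega] X,
      {ae Pr, forall w, forall (n : nat) (t : I01 R),
        \sum_(0 <= k < n) S k w <= \val t < \sum_(0 <= k < n.+1) S k w ->
        X w t = Y n w} &
      forall A : set (cadlag R), measurable A -> P A = Pr (X @^-1` A)].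

Definition start_event : set (cadlag R) := [set x | x (I01_0 R) = 0].

Definition bridge_event : set (cadlag R) :=
  [set x | x (I01_0 R) = 0 /\ x (I01_1 R) = 0].

(* P( . | X_0 = 0, X_1 = 0) *)
Definition bridge (P : probability (cadlag R) R) (A : set (cadlag R)) : \bar R :=
  (P (A `&` bridge_event) * ((fine (P bridge_event))^-1)%:E)%E.

End walk.

(** * The space of jump times *)

Definition is_config (R : realType) (p : {fset R} * {fset R}) : bool :=
  [&& all (fun t => 0 < t < 1) p.1, all (fun t => 0 < t < 1) p.2,
      [disjoint p.1 & p.2]%fset & #|` p.1| == #|` p.2|].

Record config (R : realType) : Type := Config {
  config_val :> {fset R} * {fset R} ;
  configP : is_config config_val }.

HB.instance Definition _ (R : realType) := [isSub for @config_val R].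
HB.instance Definition _ (R : realType) := [Choice of config R by <:].

Definition Up (R : realType) (U : config R) : {fset R} := (config_val U).1.
Definition Down (R : realType) (U : config R) : {fset R} := (config_val U).2.

Lemma is_config0 (R : realType) : is_config (fset0, fset0 : {fset R}).
Proof. by rewrite /is_config /= fdisjoint0X eqxx. Qed.

HB.instance Definition _ (R : realType) :=
  isPointed.Build (config R) (Config (@is_config0 R)).

Definition path_fun (R : realType) (U : config R) (t : I01 R) : int :=
  #|` [fset u in Up U | u <= \val t]|%:Z
  - #|` [fset u in Down U | u <= \val t]|%:Z.

Lemma seq_gap_right (R : realType) (l : seq R) (t : R) :
  exists2 e : R, 0 < e & forall u, u \in l -> u <= t \/ t + e <= u.
Proof.
elim: l => [|v l [e e0 IH]]; first by exists 1.
have [vt|tv] := leP v t.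
  by exists e => // u; rewrite inE => /orP[/eqP->|/IH//]; left.
exists (Num.min e (v - t)); first by rewrite lt_min e0 subr_gt0.
move=> u; rewrite inE => /orP[/eqP->|/IH[?|h]]; [right|by left|right].
  by rewrite -lerBrDl ge_min lexx orbT.
by apply: le_trans h; rewrite lerD2l ge_min lexx.
Qed.

Lemma seq_gap_left (R : realType) (l : seq R) (t : R) :
  exists2 e : R, 0 < e & forall u, u \in l -> t <= u \/ u <= t - e.
Proof.
have [e e0 h] := seq_gap_right (map -%R l) (- t).
exists e => // u ul; have /h : - u \in map -%R l by apply: map_f.
by case=> [|hu]; [rewrite lerN2; left|right; rewrite -lerN2 opprB addrC].
Qed.

(* [path_fun] inverts the map sending a path to (times of +1 jumps, times of -1
   jumps): the path of U starts at 0, and its jump at a time t > 0 is +1 if t is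
   in U^+, -1 if t is in U^-, and 0 otherwise. *)
Lemma path_fun_jump (R : realType) (U : config R) (t : I01 R) :
  exists2 e : R, 0 < e & forall s : I01 R, \val t - e < \val s < \val t ->
    path_fun U t - path_fun U s =
    (\val t \in Up U)%:Z - (\val t \in Down U)%:Z.
Proof.
have cnt (F : {fset R}) (s : R) (e : R) :
    (forall u, u \in enum_fset F -> \val t <= u \/ u <= \val t - e) ->
    \val t - e < s < \val t ->
    #|` [fset u in F | u <= \val t]| =
    ((\val t \in F) + #|` [fset u in F | (u <= s)%R]|)%N.
  move=> h /andP[es st].
  have -> : [fset u in F | u <= s] = ([fset u in F | (u <= \val t)%R] `\ \val t)%fset.
    apply/fsetP => u; rewrite !inE /=; have [uF|] := boolP (u \in F); last first.
      by rewrite andbF.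
    case: (ltgtP u (\val t)) => //= [ut|ut|->].
    - case: (h _ uF) => [tu|ue]; first by rewrite leNgt ut in tu.
      by rewrite (le_trans ue (ltW es)).
    - by apply/negbTE; rewrite -ltNge (lt_trans st).
    - by apply/negbTE; rewrite -ltNge.
  by rewrite (cardfsD1 (\val t) [fset u in F | u <= \val t]) !inE lexx andbT.
have [e1 e10 h1] := seq_gap_left (Up U) (\val t).
have [e2 e20 h2] := seq_gap_left (Down U) (\val t).
exists (Num.min e1 e2); first by rewrite lt_min e10.
move=> s /andP[es st].
rewrite /path_fun (cnt (Up U) (\val s) e1) //; last first.
  by rewrite st (le_lt_trans _ es) // lerD2l lerN2 ge_min lexx.
rewrite (cnt (Down U) (\val s) e2) //; last first.
  by rewrite st (le_lt_trans _ es) // lerD2l lerN2 ge_min lexx orbT.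
by rewrite !PoszD [X in _ + X - _]opprD addrACA addrK.
Qed.

Lemma path_fun_cadlag (R : realType) (U : config R) : is_cadlag (path_fun U).
Proof.
move=> t; split.
  have cnt (F : {fset R}) (s : R) (e : R) :
      (forall u, u \in enum_fset F -> u <= \val t \/ \val t + e <= u) ->
      \val t <= s < \val t + e ->
      [fset u in F | u <= s] = [fset u in F | u <= \val t].
    move=> h /andP[ts se]; apply/fsetP => u; rewrite !inE /=.
    have [uF|] := boolP (u \in F) => //=.
    case: (h _ uF) => [ut|eu]; first by rewrite ut (le_trans ut).
    rewrite !leNgt (lt_le_trans se eu) /=; apply/esym/negbTE; rewrite negbK.
    exact: le_lt_trans ts (lt_le_trans se eu).
  have [e1 e10 h1] := seq_gap_right (Up U) (\val t).
  have [e2 e20 h2] := seq_gap_right (Down U) (\val t).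
  exists (Num.min e1 e2); first by rewrite lt_min e10.
  move=> s /andP[ts se].
  rewrite /path_fun (cnt (Up U) (\val s) e1) ?(cnt (Down U) (\val s) e2) //.
    by rewrite ts (lt_le_trans se) // lerD2l ge_min lexx orbT.
  by rewrite ts (lt_le_trans se) // lerD2l ge_min lexx.
have [e e0 h] := path_fun_jump U t.
exists (path_fun U t - ((\val t \in Up U)%:Z - (\val t \in Down U)%:Z)).
by exists e => // s /h <-; rewrite opprB addrC subrK.
Qed.

Definition path_of (R : realType) (U : config R) : cadlag R :=
  Cadlag (path_fun_cadlag U).

(* The sigma-algebra transported from the path space. *)
HB.instance Definition _ (R : realType) :=
  Measurable.copy (config R) (g_sigma_algebra_preimageType (@path_of R)).

(* m, seen on the path space through the bijection between configurations and
   paths, is the bridge of P.  This determines m, since the measurable sets of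
   configurations are exactly the preimages by [path_of] of measurable sets. *)
Definition is_bridge_law (R : realType) (P : probability (cadlag R) R)
    (m : probability (config R) R) : Prop :=
  forall A : set (cadlag R), measurable A ->
    pushforward m (@path_of R) A = bridge P A.

(** * Graph distance and Wasserstein distance *)

Section wasserstein.
Variable R : realType.
Implicit Types (U V : config R) (r s : R).

Definition Arrow : set (R * R) :=
  [set rs | [/\ 0 < rs.1 < 1, 0 < rs.2 < 1 & rs.1 != rs.2]].

Definition Psi_pair r s (p : {fset R} * {fset R}) : {fset R} * {fset R} :=
  if (r \notin p.1) && (s \notin p.2) then (r |` p.1, s |` p.2)%fset
  else if (r \in p.1) && (s \in p.2) then (p.1 `\ r, p.2 `\ s)%fset
  else p.

(* [insubd U p] is p if p is a configuration and U otherwise. *)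
Definition Psi r s U : config R := insubd U (Psi_pair r s (config_val U)).

Definition neighbours U V : Prop :=
  U <> V /\ exists2 rs : R * R, Arrow rs & U = Psi rs.1 rs.2 V.

Definition joined (n : nat) U V : Prop :=
  exists c : nat -> config R,
    [/\ c 0%N = U, c n = V & forall k, (k < n)%N -> neighbours (c k) (c k.+1)].

Definition gdist U V : \bar R :=
  ereal_inf [set (n%:R)%:E | n in [set n | joined n U V]].

Definition Lip1 : set (config R -> R) :=
  [set f : config R -> R | measurable_fun [set: config R] f /\
           forall U V, (`|f U - f V|%:E <= gdist U V)%E].

Definition W1 (m n : probability (config R) R) : \bar R :=
  ereal_sup [set (`| \int[m]_U (f U)%:E - \int[n]_U (f U)%:E |)%E |
    f in [set f | [/\ Lip1 f,
                      m.-integrable [set: config R] (EFin \o f) &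
                      n.-integrable [set: config R] (EFin \o f)]]].

End wasserstein.

Definition besselI0 (R : realType) (x : R) : R :=
  limn (series (fun k : nat => (x / 2) ^+ (2 * k) / (k`!%:R) ^+ 2)).

(* Main.v *)
Require Import Defs.
From HB Require Import structures.
From mathcomp Require Import all_boot all_order all_algebra.
From mathcomp Require Import finmap.
From mathcomp Require Import all_classical all_reals all_analysis.
From mathcomp Require Import measurable_realfun.
From mathcomp Require Import ring lra zify.

Set Implicit Arguments.
Unset Strict Implicit.
Unset Printing Implicit Defensive.

Import Order.TTheory GRing.Theory Num.Theory.
Import numFieldNormedType.Exports.

Local Open Scope classical_set_scope.
Local Open Scope ring_scope.

(** In a closed path every step up from j is matched by a step down from j + 1.
    The rates of the steps of a path with n such pairs therefore multiply to a
    weight between nu ^ n and mu ^ n ([weight_bounds_balanced]); for the simple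
    walk the weight is 1. As the total jump rate is constant, the holding times
    are independent of the steps, and given the sequence e of steps the jump times
    are uniform on a simplex of volume 1 / (2 n)!, whatever the rates are. Hence
    the two bridge laws are mixtures of the same measures j e, with coefficients
    proportional to the weights of the words e ([bridge_law_mixture]).

    That the measures j e agree for the two walks is a computation on boxes
    ([exact_jumps_box_law]) followed by a uniqueness argument for measures
    ([jump_event_proportional]). The computation rests on the gamma law of the sums
    of holding times ([sum_le_law]) and on the lack of memory. Summing the Poisson
    weights over all words shows that almost every path starting at 0 is described
    by some word ([negligible_no_jump_event]).

    A configuration with n pairs of jumps is at distance at most n from the empty
    one ([Lip1_le_card]). The Wasserstein distance is therefore bounded by the
    total variation of the mixture coefficients, weighted by n
    ([integral_mixture_dist]). This variation is estimated through the
    intermediate weights lam ^ n with lam = sqrt (mu nu): both steps follow from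
    the moments of the weights z ^ n / n! ^ 2, whose sum is I_0 (2 sqrt z) and
    whose second moment is z I_0 (2 sqrt z) ([weighted_variation]). The outcome
    is the bound with the constant 2 in the place of 9. *)

(** * Truncated exponential series *)

Definition expsum (R : realType) (n : nat) (x : R) : R :=
  \sum_(j < n) x ^+ j / j`!%:R.

(** The probability that a Poisson variable of mean x is at least n, or that a
    gamma variable of shape n is at most x. *)
Definition gamma_cdf (R : realType) (n : nat) (x : R) : R :=
  1 - expR (- x) * expsum n x.

Section expsum.
Variable R : realType.
Implicit Types (x y d t c kappa : R) (n : nat).

Lemma expsum0 x : expsum 0 x = 0.
Proof. by rewrite /expsum big_ord0. Qed.

Lemma expsumS n x : expsum n.+1 x = expsum n x + x ^+ n / n`!%:R.
Proof. by rewrite /expsum big_ord_recr. Qed.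

Lemma expsum_at0 n : expsum n.+1 (0 : R) = 1.
Proof.
by elim: n => [|n IH]; rewrite expsumS ?expsum0 ?IH expr0n /= ?mul0r ?addr0//
   fact0 divr1 add0r.
Qed.

Lemma expsum_ge0 n x : 0 <= x -> 0 <= expsum n x.
Proof.
by move=> x0; apply: sumr_ge0 => j _; rewrite divr_ge0 ?exprn_ge0 ?ler0n.
Qed.

Lemma le_expsum n x y : 0 <= x -> x <= y -> expsum n x <= expsum n y.
Proof.
move=> x0 xy; apply: ler_sum => j _; rewrite ler_pM2r ?invr_gt0 ?ltr0n ?fact_gt0//.
by rewrite lerXn2r// ?nnegrE// (le_trans x0).
Qed.

Lemma exprB_bounds n x y : 0 <= y -> y <= x ->
  (x - y) * (n.+1%:R * y ^+ n) <= x ^+ n.+1 - y ^+ n.+1 <= (x - y) * (n.+1%:R * x ^+ n).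
Proof.
move=> y0 yx; have x0 := le_trans y0 yx.
have xy0 : 0 <= x - y by rewrite subr_ge0.
have h (z : R) : n.+1%:R * z ^+ n = \sum_(i < n.+1) z ^+ n.
  by rewrite sumr_const card_ord mulr_natl.
rewrite subrXX !h; apply/andP; split; apply: ler_wpM2l => //; apply: ler_sum => i _.
  have -> : y ^+ n = y ^+ (n.+1 - i.+1)%N * y ^+ i.
    by rewrite -exprD subSS subnK// -ltnS.
  by apply: ler_wpM2r; rewrite ?exprn_ge0// lerXn2r ?nnegrE.
have -> : x ^+ n = x ^+ (n.+1 - i.+1)%N * x ^+ i.
  by rewrite -exprD subSS subnK// -ltnS.
by apply: ler_wpM2l; rewrite ?exprn_ge0// lerXn2r ?nnegrE.
Qed.

(** The mean value theorem for [expsum n.+1], whose derivative [expsum n] is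
    nondecreasing; it is obtained term by term. *)
Lemma expsumB_bounds n x y : 0 <= y -> y <= x ->
  (x - y) * expsum n y <= expsum n.+1 x - expsum n.+1 y <= (x - y) * expsum n x.
Proof.
move=> y0 yx; elim: n => [|n /andP[IH1 IH2]].
  by rewrite !expsumS !expsum0 !expr0 !mulr0 subrr lexx.
have /andP[h1 h2] := exprB_bounds n y0 yx.
have f0 : 0 < n.+1`!%:R^-1 :> R by rewrite invr_gt0 ltr0n fact_gt0.
have e (z : R) : z ^+ n / n`!%:R = (n.+1%:R * z ^+ n) / n.+1`!%:R.
  rewrite factS natrM invfM mulrA; congr (_ / _).
  by rewrite mulrAC mulfV ?mul1r// pnatr_eq0.
rewrite (expsumS n.+1 x) (expsumS n.+1 y) opprD addrACA -mulrBl.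
rewrite [in leLHS]expsumS [X in _ && (_ <= _ * X)]expsumS !(mulrDr (x - y)) !e !mulrA.
by rewrite !lerD// ler_pM2r// -mulrA.
Qed.

Lemma expR_le_quadratic d : 0 <= d -> d <= 2^-1 -> expR d <= 1 + d + 2 * d ^+ 2.
Proof.
move=> d0 d1; have h := expR_ge1Dx (- d).
have p : 0 < 1 - d by lra.
have : expR d <= (1 - d)^-1.
  by rewrite -[d in expR d]opprK expRN lef_pV2// posrE ?expR_gt0//.
move/le_trans; apply; rewrite -[leLHS]mul1r ler_pdivrMr//; nra.
Qed.

(** A uniqueness statement for the renewal equation of the gamma laws. When the
    last of n + 1 exponential variables is cut into M slices of width t / M, the
    contribution [x M p] of the slices from p on has increments squeezed between
    two values of the gamma law of shape n. The explicit candidate, y in the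
    proof, has the same increments up to O(1 / M ^ 2), so that X differs from its
    first value by O(1 / M). *)
Lemma gamma_cdf_slices n kappa t c (X : R) (x : nat -> nat -> R) :
  0 <= kappa -> 0 <= t -> 0 <= c ->
  (forall M, (0 < M)%N -> x M 0%N = X /\ x M M = 0) ->
  (forall M p, (p < M)%N ->
    let u := p%:R * (t / M%:R) in let v := p.+1%:R * (t / M%:R) in
    c * (expR (- (kappa * u)) - expR (- (kappa * v))) * gamma_cdf n (kappa * (t - v))
      <= x M p - x M p.+1
      <= c * (expR (- (kappa * u)) - expR (- (kappa * v))) * gamma_cdf n (kappa * (t - u))) ->
  X = c * gamma_cdf n.+1 (kappa * t).
Proof.
move=> k0 t0 c0 x0 xs.
pose C := c * (2 * (kappa * t) ^+ 2 * expsum n (kappa * t)).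
have C0 : 0 <= C by rewrite !mulr_ge0// ?exprn_ge0 ?expsum_ge0 ?mulr_ge0.
have key M : (0 < M)%N -> 2 * (kappa * t) <= M%:R ->
    `|X - c * gamma_cdf n.+1 (kappa * t)| <= C / M%:R.
  move=> M0 Mk; have M0' : 0 < M%:R :> R by rewrite ltr0n.
  pose h := t / M%:R; pose d := kappa * h.
  have h0 : 0 <= h by rewrite divr_ge0// ltW.
  have d0 : 0 <= d by rewrite mulr_ge0.
  have d1 : d <= 2^-1.
    by rewrite /d /h mulrA ler_pdivrMr//; lra.
  have Mh : M%:R * h = t by rewrite /h mulrCA mulfV ?mulr1// gt_eqF.
  pose y p := c * (expR (- (kappa * (p%:R * h))) * gamma_cdf n.+1 (kappa * (t - p%:R * h))).
  have step p : (p < M)%N -> `|(x M p - y p) - (x M p.+1 - y p.+1)|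
      <= c * (2 * d ^+ 2 * expsum n (kappa * t)).
    move=> pM; have := xs M p pM; rewrite -/h /=.
    set u := p%:R * h; set v := p.+1%:R * h => xsp.
    have uv : v = u + h by rewrite /u /v -natr1 mulrDl mul1r.
    have vt : v <= t by rewrite -Mh /v; apply: ler_wpM2r => //; rewrite ler_nat.
    pose a := kappa * (t - u); pose b := kappa * (t - v).
    have b0 : 0 <= b by rewrite mulr_ge0// subr_ge0.
    have ab : a = b + d by rewrite /a /b /d uv; ring.
    have u0 : 0 <= u by rewrite mulr_ge0.
    have at_ : a <= kappa * t by rewrite ler_wpM2l//; lra.
    have eu : expR (- (kappa * u)) = expR (- (kappa * t)) * expR a.
      by rewrite -expRD; congr expR; rewrite /a; ring.
    have ev : expR (- (kappa * v)) = expR (- (kappa * t)) * expR b.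
      by rewrite -expRD; congr expR; rewrite /b; ring.
    have eb : expR a = expR b * expR d by rewrite ab expRD.
    (* Both increments are compared to the mass of the slice, up to Poisson terms. *)
    have ey p' z : expR (- (kappa * z)) = expR (- (kappa * t)) * expR (kappa * (t - z)) ->
       p'%:R * h = z ->
       y p' = c * expR (- (kappa * z)) - c * expR (- (kappa * t)) * expsum n.+1 (kappa * (t - z)).
      move=> e1 e2; rewrite /y e2 /gamma_cdf e1.
      have := expRxMexpNx_1 (kappa * (t - z)).
      set A := expR (kappa * (t - z)); set B := expR (- _) => AB.
      set E := expR (- (kappa * t)).
      rewrite [LHS](_ : _ = c * (E * A) - c * E * (A * B) * expsum n.+1 (kappa * (t - z))); last by ring.
      by rewrite AB mulr1.
    have yy : y p - y p.+1 = c * (expR (- (kappa * u)) - expR (- (kappa * v)))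
        - c * expR (- (kappa * t)) * (expsum n.+1 a - expsum n.+1 b).
      by rewrite (ey p u)// (ey p.+1 v)// -/a -/b; ring.
    have /andP[s1 s2] : d * expsum n b <= expsum n.+1 a - expsum n.+1 b <= d * expsum n a.
      have -> : d = a - b by rewrite ab; ring.
      by apply: expsumB_bounds => //; rewrite ab lerDl.
    have Et1 : expR (- (kappa * t)) <= 1.
      by rewrite -expR0 ler_expR oppr_le0 mulr_ge0.
    have Et0 := expR_gt0 (- (kappa * t)).
    have pb : expsum n b <= expsum n (kappa * t).
      by apply: le_expsum => //; apply: le_trans at_; rewrite ab lerDl.
    have pa : expsum n a <= expsum n (kappa * t).
      by apply: le_expsum => //; rewrite ab addr_ge0.
    have pb0 := expsum_ge0 n b0.
    have pa0 : 0 <= expsum n a by apply: expsum_ge0; rewrite ab addr_ge0.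
    have q1 := expR_le_quadratic d0 d1.
    have q2 := expR_ge1Dx d.
    have q3 := expR_ge1Dx (- d).
    have q4 : expR (- d) <= 1 - d + d ^+ 2.
      have : (1 + d) * expR (- d) <= 1.
        by rewrite -[leRHS](expRxMexpNx_1 d) ler_wpM2r ?expR_ge0.
      move=> h'; have := expR_ge0 (-d); nra.
    move: xsp; rewrite -/a -/b /gamma_cdf.
    have r1 : c * (expR (- (kappa * u)) - expR (- (kappa * v))) * (1 - expR (- b) * expsum n b)
       = c * (expR (- (kappa * u)) - expR (- (kappa * v)))
         - c * expR (- (kappa * t)) * ((expR d - 1) * expsum n b).
      rewrite eu ev eb.
      have := expRxMexpNx_1 b; set A := expR b; set B := expR (- b) => AB.
      set E := expR (- (kappa * t)).
      rewrite [LHS](_ : _ = c * (E * (A * expR d) - E * A)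
         - c * E * ((expR d - 1) * expsum n b) * (A * B)); last by ring.
      by rewrite AB mulr1.
    have r2 : c * (expR (- (kappa * u)) - expR (- (kappa * v))) * (1 - expR (- a) * expsum n a)
       = c * (expR (- (kappa * u)) - expR (- (kappa * v)))
         - c * expR (- (kappa * t)) * ((1 - expR (- d)) * expsum n a).
      have eb' : expR b = expR a * expR (- d) by rewrite -expRD ab; congr expR; ring.
      rewrite eu ev eb'.
      have := expRxMexpNx_1 a; set A := expR a; set B := expR (- a) => AB.
      set E := expR (- (kappa * t)).
      rewrite [LHS](_ : _ = c * (E * A - E * (A * expR (- d)))
         - c * E * ((1 - expR (- d)) * expsum n a) * (A * B)); last by ring.
      by rewrite AB mulr1.
    rewrite r1 r2 => /andP[g1 g2].
    have -> : (x M p - y p) - (x M p.+1 - y p.+1) = (x M p - x M p.+1) - (y p - y p.+1) by ring.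
    rewrite yy.
    set E := expR (- (kappa * t)) in Et1 Et0 g1 g2 *.
    set W := c * (expR _ - expR _) in g1 g2 *.
    set D := x M p - x M p.+1 in g1 g2 *.
    set Sm := expsum n.+1 a - expsum n.+1 b in s1 s2 *.
    have cE0 : 0 <= c * E by rewrite mulr_ge0// ltW.
    have cE1 : c * E <= c by rewrite -[leRHS]mulr1 ler_wpM2l.
    set T := 2 * d ^+ 2 * expsum n (kappa * t).
    have T0 : 0 <= T by rewrite !mulr_ge0// (le_trans pb0).
    have u1 : Sm - (1 - expR (- d)) * expsum n a <= T.
      apply: (@le_trans _ _ (d * expsum n a - (1 - expR (- d)) * expsum n a)); first by rewrite lerB.
      rewrite -mulrBl /T; apply: ler_pM => //; nra.
    have u2 : (expR d - 1) * expsum n b - Sm <= T.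
      apply: (@le_trans _ _ ((expR d - 1) * expsum n b - d * expsum n b)); first by rewrite lerB.
      rewrite -mulrBl /T; apply: ler_pM => //; nra.
    have cT : c * E * T <= c * T by rewrite ler_wpM2r.
    rewrite ler_norml; apply/andP; split.
      have := ler_wpM2l cE0 u2; nra.
    have := ler_wpM2l cE0 u1; nra.
  have tot p : (p <= M)%N -> `|x M (M - p)%N - y (M - p)%N|
      <= p%:R * (c * (2 * d ^+ 2 * expsum n (kappa * t))).
    elim: p => [_|p IH pM].
      rewrite subn0 mul0r (x0 M M0).2 sub0r normrN /y Mh subrr mulr0 /gamma_cdf.
      by rewrite expsum_at0 oppr0 expR0 mulr1 subrr !mulr0 normr0.
    have e : (M - p = (M - p.+1).+1)%N by rewrite subnSK.
    have := step (M - p.+1)%N; rewrite -e => /(_ _)/wrap[].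
      exact: leq_subr.
    move: (IH (ltnW pM)) => i1 i2.
    rewrite -natr1 mulrDl mul1r.
    rewrite -[X in `|X|](subrK (x M (M - p)%N - y (M - p)%N)) addrC.
    by apply: le_trans (ler_normD _ _) _; rewrite lerD.
  have y0 : y 0%N = c * gamma_cdf n.+1 (kappa * t).
    by rewrite /y !mul0r mulr0 oppr0 expR0 mul1r addr0.
  have := tot M (leqnn M); rewrite subnn (x0 M M0).1 y0.
  move/le_trans; apply; rewrite le_eqVlt; apply/orP; left; apply/eqP.
  have e : d = kappa * t / M%:R by rewrite /d /h mulrA.
  rewrite e /C; field; by rewrite gt_eqF.
apply/eqP; rewrite -subr_eq0 -normr_eq0 eq_le normr_ge0 andbT.
apply/ler_addgt0Pr => e e0; rewrite add0r.
pose M := (Num.truncn (C / e + 2 * (kappa * t))).+1.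
have MM : C / e + 2 * (kappa * t) < M%:R.
  by have := truncnS_gt (C / e + 2 * (kappa * t)).
have kt0 : 0 <= kappa * t by rewrite mulr_ge0.
have Ce0 : 0 <= C / e by rewrite divr_ge0// ltW.
apply: le_trans (key M _ _) _ => //; first by lra.
rewrite ler_pdivrMr ?ltr0n// mulrC -ler_pdivrMr//; lra.
Qed.

End expsum.

(** * Partial sums of exponential holding times *)

Section gamma_law.
Context d (Omega : measurableType d) (R : realType)
  (m : {measure set Omega -> \bar R}) (S : nat -> Omega -> R).
Hypothesis mS : forall n, measurable_fun [set: Omega] (S n).
Variable kappa : R.
Hypothesis kappa0 : 0 <= kappa.

Definition box (n : nat) (s : nat -> R) : set Omega :=
  [set w | forall k, (k < n)%N -> s k < S k w].

Definition sum_le (n : nat) (t : R) : set Omega :=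
  box n (fun=> 0) `&` [set w | \sum_(0 <= k < n) S k w <= t].

Definition sum_lt (n : nat) (t : R) : set Omega :=
  box n (fun=> 0) `&` [set w | \sum_(0 <= k < n) S k w < t].

(** Up to the total mass c, the first n of the S k are on D independent and
    exponential of rate kappa. The set D collects all other conditions, on later
    variables or on the jump chain, so that an induction may move S n into it. *)
Definition exponential_on (D : set Omega) (n : nat) (c : R) : Prop :=
  forall s : nat -> R, (forall k, 0 <= s k) ->
    m (D `&` box n s) = (c * \prod_(0 <= k < n) expR (- (kappa * s k)))%:E.

Lemma measure_setD (A B : set Omega) (x y : R) :
  measurable A -> measurable B -> B `<=` A -> m A = x%:E -> m B = y%:E ->
  m (A `\` B) = (x - y)%:E.
Proof.
move=> mA mB BA mx my; rewrite EFinB -mx -my.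
have -> : m B = m (A `&` B) by rewrite setIidr.
have mA_fin : (m A < +oo)%E by rewrite mx ltry.
exact: measureD.
Qed.

Lemma measurable_set_gt (f : Omega -> R) (x : R) :
  measurable_fun [set: Omega] f -> measurable [set w | x < f w].
Proof.
move=> mf; rewrite -[X in measurable X]setTI.
have -> : [set w | x < f w] = f @^-1` `]x, +oo[.
  by apply/seteqP; split=> w /=; rewrite in_itv /= andbT.
exact: mf.
Qed.

Lemma measurable_set_le (f : Omega -> R) (x : R) :
  measurable_fun [set: Omega] f -> measurable [set w | f w <= x].
Proof.
move=> mf; rewrite -[X in measurable X]setTI.
have -> : [set w | f w <= x] = f @^-1` `]-oo, x].
  by apply/seteqP; split=> w /=; rewrite in_itv.
exact: mf.
Qed.

Lemma measurable_set_lt (f : Omega -> R) (x : R) :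
  measurable_fun [set: Omega] f -> measurable [set w | f w < x].
Proof.
move=> mf; rewrite -[X in measurable X]setTI.
have -> : [set w | f w < x] = f @^-1` `]-oo, x[.
  by apply/seteqP; split=> w /=; rewrite in_itv.
exact: mf.
Qed.

Lemma measurable_box n s : measurable (box n s).
Proof.
have -> : box n s = \bigcap_(k in `I_n) [set w | s k < S k w].
  by apply/seteqP; split=> w /=.
by apply: bigcap_measurableType => k _; apply: measurable_set_gt.
Qed.

Lemma measurable_sum_S n : measurable_fun [set: Omega] (fun w => \sum_(0 <= k < n) S k w).
Proof. by apply: measurable_sum. Qed.

Lemma measurable_sum_le n t : measurable (sum_le n t).
Proof.
by apply: measurableI; [exact: measurable_box|exact/measurable_set_le/measurable_sum_S].
Qed.

Lemma measurable_sum_lt n t : measurable (sum_lt n t).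
Proof.
by apply: measurableI; [exact: measurable_box|exact/measurable_set_lt/measurable_sum_S].
Qed.

Lemma boxS n s : box n.+1 s = box n s `&` [set w | s n < S n w].
Proof.
apply/seteqP; split=> w /=.
  by move=> h; split=> [k kn|]; apply: h => //; exact: ltnW.
by move=> [h1 h2] k; rewrite ltnS leq_eqVlt => /orP[/eqP->//|]; exact: h1.
Qed.

Lemma exponential_on_gt D n c u : 0 <= u -> exponential_on D n.+1 c ->
  exponential_on (D `&` [set w | u < S n w]) n (c * expR (- (kappa * u))).
Proof.
move=> u0 H s s0; pose s' k := if k == n then u else s k.
have := H s' (fun k => _); rewrite boxS /s' eqxx => /(_ _)/wrap[].
  by move=> k; case: ifP.
rewrite big_nat_recr//= eqxx (_ : \prod_(0 <= k < n) _ = \prod_(0 <= k < n) expR (- (kappa * s k))).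
  rewrite (_ : box n _ = box n s); first by rewrite mulrCA mulrC setIAC setIA => ->; rewrite mulrC mulrCA.
  by apply/seteqP; split=> w h k kn; have := h k kn; rewrite ltn_eqF.
by apply: eq_big_nat => k /andP[_ kn]; rewrite ltn_eqF.
Qed.

Lemma exponential_on_setD D n c u v : measurable D ->
  0 <= u -> u <= v -> exponential_on D n.+1 c ->
  exponential_on (D `&` [set w | u < S n w <= v]) n
    (c * (expR (- (kappa * u)) - expR (- (kappa * v)))).
Proof.
move=> mD u0 uv H s s0.
have mS' x : measurable [set w | x < S n w] by apply: measurable_set_gt.
have mB := measurable_box n s.
have -> : D `&` [set w | u < S n w <= v] `&` box n s =
   (D `&` [set w | u < S n w] `&` box n s) `\` (D `&` [set w | v < S n w] `&` box n s).
  apply/seteqP; split=> w /=.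
    move=> [[Dw /andP[uw wv]] bw]; split => //; move=> [[_ h] _].
    by rewrite ltNge wv in h.
  move=> [[[Dw uw] bw] h]; split=> //; split=> //; rewrite uw leNgt; apply/negP => vw.
  by apply: h.
have e1 := exponential_on_gt u0 H s0.
have e2 := exponential_on_gt (le_trans u0 uv) H s0.
rewrite (measure_setD _ _ _ e1 e2); first by congr EFin; ring.
- by apply: measurableI => //; exact: measurableI.
- by apply: measurableI => //; exact: measurableI.
by move=> w /= [[Dw vw] bw]; split=> //; split=> //; exact: le_lt_trans vw.
Qed.

Lemma prod_expR0 n : \prod_(0 <= k < n) expR (- (kappa * (fun=> 0 : R) k)) = 1.
Proof. by rewrite big1// => k _; rewrite mulr0 oppr0 expR0. Qed.

(** The gamma law of the n-th partial sum, without convolution integrals: the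
    last variable is cut into slices of width t / M, and the induction hypothesis
    applies to the set D cut by one slice, where S n is known up to t / M. *)
Lemma sum_le_law n D c t : measurable D -> 0 <= c -> 0 <= t -> exponential_on D n c ->
  m (D `&` sum_le n t) = (c * gamma_cdf n (kappa * t))%:E.
Proof.
elim: n D c t => [|n IH] D c t mD c0 t0 H.
  have := H (fun=> 0) (fun=> lexx _); rewrite prod_expR0 /gamma_cdf expsum0 mulr0 subr0.
  move=> <-; congr (m (_ `&` _)).
  by apply/seteqP; split=> w; [case|move=> h; split=> //=; rewrite big_nil].
have Hfin E : measurable E -> E `<=` D `&` box n.+1 (fun=> 0) -> (m E < +oo)%E.
  move=> mE ED; apply: le_lt_trans (_ : (m (D `&` box n.+1 (fun=> 0%R)) < +oo)%E).
    apply: le_measure => //; rewrite ?inE//.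
    by apply: measurableI => //; exact: measurable_box.
  by rewrite H// ltry.
pose A u := D `&` sum_le n.+1 t `&` [set w | u < S n w].
have mS' x : measurable [set w | x < S n w] by apply: measurable_set_gt.
have mS2 x y : measurable [set w | x < S n w <= y].
  have -> : [set w | x < S n w <= y] = [set w | x < S n w] `&` [set w | S n w <= y].
    by apply/seteqP; split=> w /=; [move=> /andP[]|move=> [-> ->]].
  by apply: measurableI => //; exact: measurable_set_le.
have mA u : measurable (A u).
  by do 2 apply: measurableI => //; exact: measurable_sum_le.
have Afin u : (m (A u) < +oo)%E.
  by apply: Hfin => // w [[Dw [bw _]] _]; split.
have A0 : A 0 = D `&` sum_le n.+1 t.
  apply/seteqP; split=> w; first by case.
  by move=> [Dw [bw sw]]; split; [split|exact: bw].
rewrite -A0.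
have mfin u : m (A u) = (fine (m (A u)))%:E.
  by rewrite fineK// ge0_fin_numE.
rewrite mfin; congr EFin.
apply: (@gamma_cdf_slices _ n kappa t c _ (fun M p => fine (m (A (p%:R * (t / M%:R)))))) => //.
  move=> M M0; rewrite mul0r; split => //.
  rewrite mulrCA mulfV ?pnatr_eq0 -?lt0n// mulr1.
  rewrite (_ : A t = set0) ?measure0//; apply/seteqP; split=> w // -[[Dw [bw sw]] tw].
  move: sw => /=; rewrite big_nat_recr//= leNgt => /negP; apply.
  apply: lt_le_trans tw _; rewrite lerDr big_nat_cond; apply: sumr_ge0 => k.
  by rewrite andbT => /andP[_ kn]; apply/ltW/bw; exact: ltnW.
move=> M p pM; set u := p%:R * _; set v := p.+1%:R * _; move=> /=.
have M0 : 0 < M%:R :> R by rewrite ltr0n (leq_ltn_trans _ pM).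
have h0 : 0 <= t / M%:R by rewrite divr_ge0// ltW.
have u0 : 0 <= u by rewrite mulr_ge0.
have uv : u <= v by rewrite ler_wpM2r// ler_nat.
have vt : v <= t.
  rewrite -[leRHS](_ : M%:R * (t / M%:R) = t); first by rewrite ler_wpM2r// ler_nat.
  by rewrite mulrCA mulfV ?gt_eqF// mulr1.
pose E := D `&` [set w | u < S n w <= v].
have mE : measurable E by exact: measurableI.
have HE := exponential_on_setD mD u0 uv H.
have cE : 0 <= c * (expR (- (kappa * u)) - expR (- (kappa * v))).
  by rewrite mulr_ge0// subr_ge0 ler_expR lerN2 ler_wpM2l.
have IHE r : 0 <= r -> _ := fun r0 => IH E _ r mE cE r0 HE.
have Auv : m (A u `\` A v) = (fine (m (A u)) - fine (m (A v)))%:E.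
  apply: measure_setD; rewrite -?mfin//.
  by move=> w [? vw]; split=> //; exact: le_lt_trans vw.
apply/andP; split; rewrite -lee_fin -Auv -IHE ?subr_ge0//; last exact: le_trans vt.
  apply: le_measure; rewrite ?inE.
  - by apply: measurableI => //; exact: measurable_sum_le.
  - exact: measurableD.
  move=> w [[Dw /andP[uw wv]] [bw sw]]; split.
    split=> //; split=> //; split=> /=; first by rewrite boxS; split=> //=; exact: le_lt_trans uw.
    rewrite big_nat_recr//=; move: sw => /= sw; lra.
  by move=> [_ /=]; rewrite ltNge wv.
apply: le_measure; rewrite ?inE.
- exact: measurableD.
- by apply: measurableI => //; exact: measurable_sum_le.
move=> w [[[Dw [bw sw]] uw] nA].
have wv : S n w <= v by rewrite leNgt; apply/negP => vw; apply: nA.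
split; first by split=> //=; rewrite uw wv.
move: bw; rewrite boxS => -[bw _]; split=> //.
by move: sw uw; rewrite /= big_nat_recr//= => sw uw; lra.
Qed.

End gamma_law.

(** The gamma law has no atoms; this bound gives the law of open half-lines from
    that of closed ones. *)
Lemma gamma_cdf_increment (R : realType) n (x y : R) : 0 <= y -> y <= x ->
  gamma_cdf n x - gamma_cdf n y <= (x - y) * expsum n x.
Proof.
move=> y0 yx; rewrite /gamma_cdf.
rewrite [leLHS](_ : _ = expR (- y) * expsum n y - expR (- x) * expsum n x); last by ring.
have h1 := le_expsum n y0 yx; have h0 := expsum_ge0 n y0.
have ey : expR (- x) = expR (- y) * expR (- (x - y)) by rewrite -expRD; congr expR; ring.
have := expR_ge1Dx (- (x - y)); have Ey := expR_gt0 (- y).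
have E1 : expR (- y) <= 1 by rewrite -expR0 ler_expR oppr_le0.
have E2 : expR (- (x - y)) <= 1 by rewrite -expR0 ler_expR oppr_le0 subr_ge0.
rewrite ey; set E := expR (- y) in Ey E1 *; set d := x - y; set F := expR (- d) in E2 *.
set p := expsum n y in h0 h1 *; set q := expsum n x in h1 *.
have d0 : 0 <= d by rewrite subr_ge0.
move=> F1; have F0 : 0 < F := expR_gt0 _.
apply: (@le_trans _ _ (E * p - E * F * p)).
  by rewrite lerB// ler_wpM2l// mulr_ge0// ltW.
have -> : E * p - E * F * p = (E * (1 - F)) * p by ring.
apply: ler_pM => //; first by rewrite mulr_ge0 ?subr_ge0// ltW.
rewrite -[leRHS]mul1r; apply: ler_pM; rewrite ?subr_ge0 ?(ltW Ey)//; lra.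
Qed.

Section exact_jumps.
Context d (Omega : measurableType d) (R : realType)
  (m : {measure set Omega -> \bar R}).
Variable kappa : R.
Hypothesis kappa0 : 0 <= kappa.
Implicit Types S : nat -> Omega -> R.

Definition exact_jumps S (n : nat) (t : R) : set Omega :=
  box S n.+1 (fun=> 0) `&`
  [set w | \sum_(0 <= k < n) S k w < t < \sum_(0 <= k < n.+1) S k w].

Lemma measurable_exact_jumps S n t : (forall n, measurable_fun [set: Omega] (S n)) ->
  measurable (exact_jumps S n t).
Proof.
move=> mS; apply: measurableI; first exact: measurable_box.
have -> : [set w | \sum_(0 <= k < n) S k w < t < \sum_(0 <= k < n.+1) S k w] =
    [set w | \sum_(0 <= k < n) S k w < t] `&` [set w | t < \sum_(0 <= k < n.+1) S k w].
  by apply/seteqP; split=> w /=; [move=> /andP[]|move=> [-> ->]].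
apply: measurableI.
  exact/measurable_set_lt/measurable_sum_S.
exact/measurable_set_gt/measurable_sum_S.
Qed.

Lemma sum_lt_law S n D c t : (forall n, measurable_fun [set: Omega] (S n)) ->
  measurable D -> 0 <= c -> 0 < t -> exponential_on m S kappa D n c ->
  m (D `&` sum_lt S n t) = (c * gamma_cdf n (kappa * t))%:E.
Proof.
move=> mS mD c0 t0 H.
have mlt : measurable (D `&` sum_lt S n t).
  by apply: measurableI => //; exact: measurable_sum_lt.
have mle r : measurable (D `&` sum_le S n r).
  by apply: measurableI => //; exact: measurable_sum_le.
have le1 : (m (D `&` sum_lt S n t) <= (c * gamma_cdf n (kappa * t))%:E)%E.
  rewrite -(sum_le_law mS kappa0 mD c0 (ltW t0) H); apply: le_measure; rewrite ?inE//.
  by move=> w [Dw [bw sw]]; split=> //; split=> //; exact: ltW.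
have mfin : m (D `&` sum_lt S n t) = (fine (m (D `&` sum_lt S n t)))%:E.
  by rewrite fineK// ge0_fin_numE// (le_lt_trans le1)// ltry.
rewrite mfin lee_fin in le1 *; congr EFin; apply/eqP; rewrite eq_le le1 /=.
set X := fine _ in le1 mfin *; set Q := expsum n (kappa * t).
have Q0 : 0 <= Q by rewrite expsum_ge0// mulr_ge0// ltW.
have ge r : 0 < r -> r <= t -> c * gamma_cdf n (kappa * t) <= X + r * (c * (kappa * Q)).
  move=> r0 rt; have tr0 : 0 <= t - r by rewrite subr_ge0.
  have : c * gamma_cdf n (kappa * (t - r)) <= X.
    rewrite -lee_fin -mfin -(sum_le_law mS kappa0 mD c0 tr0 H).
    apply: le_measure; rewrite ?inE//.
    move=> w [Dw [bw /= sw]]; split=> //; split=> //=; lra.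
  have k1 : 0 <= kappa * (t - r) by rewrite mulr_ge0.
  have k2 : kappa * (t - r) <= kappa * t by rewrite ler_wpM2l//; lra.
  have := ler_wpM2l c0 (gamma_cdf_increment n k1 k2); rewrite -/Q.
  have -> : kappa * t - kappa * (t - r) = kappa * r by ring.
  have -> : r * (c * (kappa * Q)) = c * (kappa * r * Q) by ring.
  rewrite mulrBr; lra.
set K := c * (kappa * Q) in ge.
have K0 : 0 <= K by rewrite !mulr_ge0.
apply/ler_addgt0Pr => e e0.
pose r := Num.min t (e / (K + 1)).
have r0 : 0 < r by rewrite lt_min t0 divr_gt0//; lra.
apply: le_trans (ge r r0 _) _; first by rewrite ge_min lexx.
rewrite lerD2l; apply: (@le_trans _ _ (e / (K + 1) * K)).
  by rewrite ler_wpM2r// ge_min lexx orbT.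
rewrite mulrAC ler_pdivrMr; last by lra.
nra.
Qed.

Lemma exact_jumps_law S n D c t : (forall n, measurable_fun [set: Omega] (S n)) ->
  measurable D -> 0 <= c -> 0 < t -> exponential_on m S kappa D n.+1 c ->
  m (D `&` exact_jumps S n t) =
  (c * (expR (- (kappa * t)) * ((kappa * t) ^+ n / n`!%:R)))%:E.
Proof.
move=> mS mD c0 t0 H.
have m0 : measurable [set w | 0 < S n w] by exact: measurable_set_gt.
have -> : D `&` exact_jumps S n t =
    (D `&` [set w | 0 < S n w] `&` sum_lt S n t) `\` (D `&` sum_le S n.+1 t).
  apply/seteqP; split=> w.
    move=> [Dw []]; rewrite boxS => -[bw Sw] /= /andP[h1 h2]; split; first by [].
    by move=> [_ [_ /=]]; rewrite leNgt h2.
  move=> [[[Dw Sw] [bw sw]] h]; have bw' : box S n.+1 (fun=> 0) w by rewrite boxS.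
  split=> //; split=> //=; rewrite sw /= ltNge; apply/negP => h'; apply: h.
  by split.
have e1 := exponential_on_gt (lexx 0) H.
rewrite mulr0 oppr0 expR0 mulr1 in e1.
have mD0 : measurable (D `&` [set w | 0 < S n w]) by exact: measurableI.
have E1 := sum_lt_law mS mD0 c0 t0 e1.
have E2 := sum_le_law mS kappa0 mD c0 (ltW t0) H.
rewrite (measure_setD _ _ _ E1 E2).
- by congr EFin; rewrite /gamma_cdf expsumS; ring.
- by apply: measurableI => //; exact: measurable_sum_lt.
- by apply: measurableI => //; exact: measurable_sum_le.
move=> w [Dw [bw]]; rewrite boxS in bw; case: bw => bw Sw sw.
split=> //; split=> //=; move: sw Sw; rewrite /= big_nat_recr//=; lra.
Qed.

(** Lack of memory: above the lower bounds s, the excesses of the S k are again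
    exponential, and the time interval is shortened by the sum of the bounds.
    Up to the factor c * exp (- kappa t) * kappa ^ n the result does not involve
    kappa: given the number n of jumps, the spacings are uniform on a simplex. *)
Lemma exact_jumps_box_law S n D c t (s : nat -> R) :
  (forall n, measurable_fun [set: Omega] (S n)) ->
  measurable D -> 0 <= c -> 0 < t -> exponential_on m S kappa D n.+1 c ->
  m (D `&` exact_jumps S n t `&` box S n s) =
  (c * (expR (- (kappa * t)) * kappa ^+ n) *
   (Num.max 0 (t - \sum_(0 <= k < n) Num.max 0 (s k)) ^+ n / n`!%:R))%:E.
Proof.
move=> mS mD c0 t0 H.
pose r k := if (k < n)%N then Num.max 0 (s k) else 0.
have r0 k : 0 <= r k by rewrite /r; case: ifP => // _; rewrite le_max lexx.
(* The variable S n keeps its bound 0, hence the test in r. *)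
pose S' k w := S k w - r k.
have mS' k : measurable_fun [set: Omega] (S' k) by exact: measurable_funB.
have sumS' w j : (j <= n)%N ->
    \sum_(0 <= k < j) S' k w = \sum_(0 <= k < j) S k w - \sum_(0 <= k < j) r k.
  by move=> jn; rewrite sumrB.
have rE : \sum_(0 <= k < n) Num.max 0 (s k) = \sum_(0 <= k < n) r k.
  by apply: eq_big_nat => k /andP[_ kn]; rewrite /r kn.
have rn : r n = 0 by rewrite /r ltnn.
pose sr := \sum_(0 <= k < n) r k.
have boxr u w : box S' n.+1 u w <-> box S n.+1 (fun k => r k + u k) w.
  by split=> h k kn; have := h k kn; rewrite /S'; lra.
have H' : exponential_on m S' kappa D n.+1 (c * expR (- (kappa * sr))).
  move=> u u0; have -> : box S' n.+1 u = box S n.+1 (fun k => r k + u k).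
    by apply/seteqP; split=> w /boxr.
  rewrite H; last by move=> k; rewrite addr_ge0.
  congr EFin; rewrite -mulrA; congr (c * _).
  under eq_bigr do rewrite mulrDr opprD expRD.
  rewrite big_split /=; congr (_ * _).
  rewrite big_nat_recr//= rn mulr0 oppr0 expR0 mulr1.
  rewrite -expR_sum; congr expR; rewrite sumrN -mulr_sumr //.
rewrite rE -/sr.
have c'0 : 0 <= c * expR (- (kappa * sr)) by rewrite mulr_ge0// expR_ge0.
have -> : D `&` exact_jumps S n t `&` box S n s = D `&` exact_jumps S' n (t - sr).
  apply/seteqP; split=> w.
    move=> [[Dw [bw /= /andP[h1 h2]]] sw]; split=> //; split.
      move=> k kn; rewrite /S'; have := bw k kn; rewrite /r; case: ifP => kn'.
        by have := sw k kn'; rewrite subr_gt0 gt_max => -> ->.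
      by rewrite subr0.
    rewrite /= (sumS' w n)// ltrD2r h1 /= big_nat_recr//= (sumS' w n)//.
    by move: h2; rewrite big_nat_recr//= /S' rn -/sr; lra.
  move=> [Dw [bw /= /andP[h1 h2]]].
  have bw' : box S n.+1 r w by move=> k /bw; rewrite /S'; lra.
  split.
    split=> //; split; first by move=> k kn; exact: le_lt_trans (bw' k kn).
    rewrite /= (sumS' w n)// in h1; rewrite /= big_nat_recr//= (sumS' w n)// in h2.
    rewrite /= big_nat_recr//=; move: h1 h2; rewrite -/sr /S' rn; lra.
  move=> k kn; have := bw' k (ltnW kn); rewrite /r kn gt_max => /andP[]; done.
have [tr|rt] := ltP 0 (t - sr).
  rewrite (exact_jumps_law mS' mD c'0 tr H'); congr EFin.
  have -> : expR (- (kappa * t)) = expR (- (kappa * sr)) * expR (- (kappa * (t - sr))).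
    by rewrite -expRD; congr expR; ring.
  by rewrite exprMn; ring.
have n0 : (0 < n)%N.
  rewrite lt0n; apply/eqP => n0; move: rt; rewrite /sr n0 big_nil subr0.
  by rewrite leNgt t0.
rewrite expr0n (gtn_eqF n0) /= mul0r mulr0.
rewrite (_ : _ `&` _ = set0) ?measure0//; apply/seteqP; split=> w //.
move=> [Dw [bw /= /andP[h1 h2]]].
have : 0 <= \sum_(0 <= k < n) S' k w.
  rewrite big_nat_cond; apply: sumr_ge0 => k; rewrite andbT => /andP[_ kn].
  by apply/ltW/bw; exact: ltnW.
by move=> /le_lt_trans/(_ h1); rewrite ltNge rt.
Qed.

End exact_jumps.

(** * Words of steps and their weights *)

Section words.
Variable R : realType.
Implicit Types (a b : int -> R) (e : seq bool) (n k : nat).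

Definition jump (u : bool) : int := if u then 1 else - 1.

Definition height e k : int := \sum_(u <- take k e) jump u.

Definition balanced e : bool := count id e == count negb e.

Definition weight a b e : R :=
  \prod_(0 <= k < size e) (if nth true e k then a else b) (height e k).

Lemma height0 e : height e 0 = 0.
Proof. by rewrite /height take0 big_nil. Qed.

Lemma heightS e k : (k < size e)%N -> height e k.+1 = height e k + jump (nth true e k).
Proof. by move=> ke; rewrite /height (take_nth true ke) big_rcons /= addrC. Qed.

Lemma height_rcons e u k : (k <= size e)%N -> height (rcons e u) k = height e k.
Proof. by move=> ke; rewrite /height -cats1 takel_cat. Qed.

Lemma height_size e : height e (size e) = (count id e)%:Z - (count negb e)%:Z.
Proof.
rewrite /height take_size; elim: e => [|u e IH]; first by rewrite big_nil.
rewrite big_cons IH /=; case: u => /=; lia.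
Qed.

Lemma balancedE e : balanced e = (height e (size e) == 0).
Proof. by rewrite height_size subr_eq0 eqz_nat. Qed.

Lemma weight_rcons a b e u : weight a b (rcons e u) =
  weight a b e * (if u then a else b) (height e (size e)).
Proof.
rewrite /weight size_rcons big_nat_recr//= nth_rcons ltnn eqxx height_rcons//.
congr (_ * _); apply: eq_big_nat => k /andP[_ ke].
by rewrite nth_rcons ke height_rcons// ltnW.
Qed.

Lemma weight_gt0 a b e : (forall j, 0 < a j) -> (forall j, 0 < b j) -> 0 < weight a b e.
Proof. by move=> a0 b0; apply: prodr_gt0 => k _; case: nth. Qed.

Lemma weight1 e : weight (fun=> 1) (fun=> 1) e = 1.
Proof. by rewrite /weight big1// => k _; case: nth. Qed.

(** The solution of H 0 = 1, H (j + 1) = a j * H j on the integers. *)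
Definition potential a (j : int) : R :=
  match j with
  | Posz n => \prod_(0 <= k < n) a k%:Z
  | Negz n => \prod_(0 <= k < n.+1) (a (Negz k))^-1
  end.

Lemma potential_gt0 a j : (forall j, 0 < a j) -> 0 < potential a j.
Proof. by move=> a0; case: j => n; apply: prodr_gt0 => k _; rewrite ?invr_gt0. Qed.

Lemma potentialS a j : (forall j, 0 < a j) -> potential a (j + 1) = potential a j * a j.
Proof.
move=> a0; case: j => [n|[|n]].
- by rewrite -PoszD addn1 /= big_nat_recr.
- by rewrite /= big_nat1 big_nil mulVf// gt_eqF.
have -> : Negz n.+1 + 1 = Negz n by lia.
by rewrite /= [in RHS]big_nat_recr//= mulfVK// gt_eqF.
Qed.

(** Each step down from j + 1 to j is paired with a step up from j to j + 1 by
    the potential: up to a factor depending only on the end point, only the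
    products a j * b (j + 1) over the steps down remain. *)
Lemma weight_bounds a b nu mu e :
  (forall j, 0 < a j) -> (forall j, 0 < b j) -> 0 < nu ->
  (forall j, nu <= a j * b (j + 1) <= mu) ->
  nu ^+ count negb e * potential a (height e (size e)) <= weight a b e
    <= mu ^+ count negb e * potential a (height e (size e)).
Proof.
move=> a0 b0 nu0 ab; elim/last_ind: e => [|e u IH].
  by rewrite /weight /height !big_nil /= big_nil mulr1 lexx.
have mu0 : 0 < mu by have /andP[h1 h2] := ab 0; exact: lt_le_trans nu0 (le_trans h1 h2).
rewrite weight_rcons size_rcons heightS ?size_rcons// height_rcons// nth_rcons ltnn eqxx.
rewrite -cats1 count_cat /= addn0.
set h := height e (size e) in IH *.
have H0 := potential_gt0 h a0.
case: u => /=.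
  by rewrite potentialS// addn0 !mulrA !ler_pM2r.
rewrite addn1 !exprSr.
have := potentialS (h - 1) a0; rewrite subrK => Hh.
have := ab (h - 1); rewrite subrK => /andP[ab1 ab2].
have H1 := potential_gt0 (h - 1) a0.
move: IH; rewrite Hh => /andP[IH1 IH2].
have a1 := a0 (h - 1); have bh := b0 h.
set p := potential a (h - 1) in H1 IH1 IH2 *; set A := a (h - 1) in ab1 ab2 a1 IH1 IH2 *.
set B := b h in ab1 ab2 bh *; set W := weight a b e in IH1 IH2 *.
set N := nu ^+ _ in IH1 *; set M := mu ^+ _ in IH2 *.
have N0 : 0 < N by rewrite exprn_gt0.
have M0 : 0 < M by rewrite exprn_gt0.
apply/andP; split.
  apply: (@le_trans _ _ (N * (p * A) * B)); last by rewrite ler_pM2r.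
  rewrite [leRHS](_ : _ = (N * p) * (A * B)); last by ring.
  rewrite [leLHS](_ : _ = (N * p) * nu); last by ring.
  by rewrite ler_pM2l// mulr_gt0.
apply: (@le_trans _ _ (M * (p * A) * B)); first by rewrite ler_pM2r.
rewrite [leLHS](_ : _ = (M * p) * (A * B)); last by ring.
rewrite [leRHS](_ : _ = (M * p) * mu); last by ring.
by rewrite ler_pM2l// mulr_gt0.
Qed.

(** The potential takes the same value at both ends of a closed path. *)
Lemma weight_bounds_balanced a b nu mu e :
  (forall j, 0 < a j) -> (forall j, 0 < b j) -> 0 < nu ->
  (forall j, nu <= a j * b (j + 1) <= mu) -> balanced e ->
  nu ^+ (size e)./2 <= weight a b e <= mu ^+ (size e)./2.
Proof.
move=> a0 b0 nu0 ab eb.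
have -> : (size e)./2 = count negb e.
  rewrite -(count_predC id e) (eqP eb : count id e = _).
  by rewrite (_ : count (predC id) e = count negb e)// addnn doubleK.
have := weight_bounds e a0 b0 nu0 ab.
by move: eb; rewrite balancedE => /eqP ->; rewrite /= big_nil !mulr1.
Qed.

Fixpoint words n : seq (seq bool) :=
  if n is k.+1 then [seq rcons e true | e <- words k] ++ [seq rcons e false | e <- words k]
  else [:: [::]].

Lemma mem_words n e : (e \in words n) = (size e == n).
Proof.
elim: n e => [|n IH] e /=; first by rewrite inE size_eq0.
rewrite mem_cat; case/lastP: e => [|e u].
  by apply/negbTE; rewrite negb_or; apply/andP; split; apply/mapP => -[[|? ?]].
rewrite size_rcons eqSS -IH.
have inj v : injective (fun e : seq bool => rcons e v) by move=> ? ? /rcons_inj[].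
have neq v : ~~ u = v -> rcons e u \in [seq rcons e0 v | e0 <- words n] = false.
  move=> uv; apply/negbTE/mapP => -[e0 _ /rcons_inj[_ uv']].
  by move: uv; rewrite uv'; case: v {uv'}.
case: u neq => neq; rewrite (mem_map (@inj _)).
  by rewrite neq// orbF.
by rewrite neq.
Qed.

Lemma uniq_words n : uniq (words n).
Proof.
elim: n => //= n IH; have inj v : injective (fun e : seq bool => rcons e v).
  by move=> ? ? /rcons_inj[].
rewrite cat_uniq !map_inj_uniq// IH andbT /=.
by apply/hasPn => _ /mapP[e _ ->]; apply/mapP => -[e' _ /rcons_inj[]].
Qed.

Lemma sum_weight_words a b kappa n : (forall j, a j + b j = kappa) ->
  \sum_(e <- words n) weight a b e = kappa ^+ n.
Proof.
move=> ab; elim: n => [|n IH]; first by rewrite /= big_seq1 /weight big_nil.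
rewrite /= big_cat /= !big_map -big_split /= exprSr -IH mulr_suml.
by apply: eq_bigr => e _; rewrite !weight_rcons -mulrDr ab.
Qed.

Lemma count_words_up n k : count (fun e => count id e == k) (words n) = 'C(n, k).
Proof.
elim: n k => [|n IH] k /=; first by case: k.
rewrite count_cat !count_map.
have e u : preim (fun e => rcons e u) (fun e => count id e == k) =1
    (fun e => (count id e + u == k)%N).
  by move=> w /=; rewrite -cats1 count_cat /= addn0.
rewrite (eq_count (e true)) (eq_count (e false)) /=.
case: k {e} => [|k].
  rewrite bin0 (eq_count (a2 := pred0)); last by move=> w; rewrite /= addn1.
  rewrite count_pred0 add0n -(bin0 n) -IH; apply: eq_count => w; by rewrite addn0.
rewrite binS addnC -!IH; congr addn; apply: eq_count => w /=; by rewrite ?addn0 ?addn1 ?eqSS.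
Qed.

Lemma count_balanced n : count balanced (words n) = if odd n then 0 else 'C(n, n./2).
Proof.
have h : {in words n, balanced =1 (fun e => (count id e).*2 == n)}.
  move=> e; rewrite mem_words => /eqP <-.
  rewrite -(count_predC id e) (_ : count (predC id) e = count negb e)//.
  by rewrite -addnn eqn_add2l.
rewrite (eq_in_count h); case: ifP => on.
  rewrite (eq_count (a2 := pred0)) ?count_pred0// => e /=.
  by apply/negbTE/eqP => en; move: on; rewrite -en odd_double.
rewrite -count_words_up; apply: eq_count => e.
by rewrite -{1}(even_halfK (negbT on)) -!muln2 eqn_pmul2r.
Qed.

End words.

Section regroup.
Variable R : realType.
Local Open Scope ereal_scope.

(** The enumeration of the words by [pickle] is arbitrary; as the terms are
    nonnegative they may be grouped by length. *)
Lemma nneseries_words (G : seq bool -> \bar R) : (forall e, 0 <= G e) ->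
  \sum_(k <oo) oapp G 0 (pickle_inv k) = \sum_(n <oo) \sum_(e <- words n) G e.
Proof.
move=> G0.
have F0 k : 0 <= oapp G 0 (@pickle_inv (seq bool) k) by case: pickle_inv.
rewrite nneseries_esumT//.
transitivity (\esum_(e in [set: seq bool]) G e).
  transitivity (\esum_(k in range (@choice.pickle (seq bool))) oapp G 0 (@pickle_inv (seq bool) k)).
    rewrite [RHS]esum_mkcond; apply: eq_esum => k _; case: ifPn => //.
    rewrite notin_setE => h; case E : (pickle_inv _) => [e|]//=.
    by exfalso; apply: h; exists e => //; have := @pickle_invK (seq bool) k; rewrite E.
  rewrite (reindex_esum [set: seq bool] _ (@choice.pickle (seq bool))).
    by apply: eq_esum => e _; rewrite pickleK_inv.
  split; first by move=> e _; exists e.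
    by move=> e e' _ _; exact: (pcan_inj pickleK_inv).
  by move=> _ [e _ <-]; exists e.
rewrite (_ : [set: seq bool] = \bigcup_(n in [set: nat]) [set` words n]); last first.
  by apply/seteqP; split=> e // _; exists (size e) => //=; rewrite mem_words.
rewrite esum_bigcupT//; last first.
  apply/trivIsetP => i j _ _ ij; apply/seteqP; split=> e //= -[].
  by rewrite !mem_words => /eqP -> /eqP ij'; rewrite ij' eqxx in ij.
rewrite nneseries_esumT; last by move=> n; exact: sume_ge0.
apply: eq_esum => n _; rewrite esum_fset//.
  by rewrite -fsbig_seq// uniq_words.
exact: finite_seq.
Qed.

(** The sum over the step sequences of closed paths, written as a series over the
    codes of the words because countable additivity is about series. *)
Definition balanced_sum (F : seq bool -> \bar R) : \bar R :=
  \sum_(k <oo) oapp (fun e => if balanced e then F e else 0) 0 (pickle_inv k).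

Implicit Types F G : seq bool -> \bar R.

Lemma eq_balanced_sum F G : (forall e, balanced e -> F e = G e) ->
  balanced_sum F = balanced_sum G.
Proof.
move=> FG; apply: eq_eseriesr => k _; case: pickle_inv => //= e.
by case: ifP => // /FG.
Qed.

Lemma le_balanced_sum F G : (forall e, balanced e -> 0 <= F e) ->
  (forall e, balanced e -> F e <= G e) -> balanced_sum F <= balanced_sum G.
Proof.
move=> F0 FG; apply: lee_nneseries => k; first by case: pickle_inv => //= e; case: ifP => // /F0.
by case: pickle_inv => //= e; case: ifP => // /FG.
Qed.

Lemma balanced_sum_ge0 F : (forall e, balanced e -> 0 <= F e) -> 0 <= balanced_sum F.
Proof.
by move=> F0; apply: nneseries_ge0 => k _ _; case: pickle_inv => //= e; case: ifP => // /F0.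
Qed.

Lemma balanced_sumZl (c : R) F : (0 <= c)%R -> (forall e, balanced e -> 0 <= F e) ->
  balanced_sum (fun e => c%:E * F e) = c%:E * balanced_sum F.
Proof.
move=> c0 F0; rewrite /balanced_sum -nneseriesZl; last first.
  by move=> k _; case: pickle_inv => //= e; case: ifP => // /F0.
by apply: eq_eseriesr => k _; case: pickle_inv => [e|] /=; [case: ifP|]; rewrite ?mule0.
Qed.

Lemma balanced_sumD F G : (forall e, balanced e -> 0 <= F e) ->
  (forall e, balanced e -> 0 <= G e) ->
  balanced_sum (fun e => F e + G e) = balanced_sum F + balanced_sum G.
Proof.
move=> F0 G0; rewrite /balanced_sum -nneseriesD.
- apply: eq_eseriesr => k _; case: pickle_inv => [e|] /=; last by rewrite adde0.
  by case: ifP => //; rewrite adde0.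
- by move=> k _; case: pickle_inv => //= e; case: ifP => // /F0.
- by move=> k _; case: pickle_inv => //= e; case: ifP => // /G0.
Qed.

(** The Bessel series appears: there are 'C(2 n, n) balanced words of length 2 n,
    and 'C(2 n, n) / (2 n)! is 1 / n! ^ 2. *)
Lemma balanced_sum_half (G : nat -> R) : (forall n, 0 <= G n)%R ->
  balanced_sum (fun e => (G (size e)./2 / (size e)`!%:R)%:E) =
  \sum_(n <oo) (G n / n`!%:R ^+ 2)%:E.
Proof.
move=> G0.
have H0 n : (0 <= G n / n`!%:R ^+ 2)%R by rewrite divr_ge0// exprn_ge0.
rewrite /balanced_sum nneseries_words; last first.
  by move=> e; case: ifP => // _; rewrite lee_fin divr_ge0.
transitivity (\sum_(n <oo) (if odd n then 0 else G n./2 / n./2`!%:R ^+ 2)%:E).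
  apply: eq_eseriesr => n _.
  rewrite (eq_big_seq (fun e => if balanced e then (G n./2 / n`!%:R)%:E else 0)); last first.
    by move=> e; rewrite mem_words => /eqP ->.
  rewrite -big_mkcond /= sumEFin; congr EFin.
  rewrite big_const_seq count_balanced iter_addr addr0; case: ifP => on //.
  have e : (n = n./2 + n./2)%N by rewrite addnn even_halfK ?on.
  have := bin_fact (leq_addr n./2 n./2); rewrite addKn -e => <-.
  rewrite -[LHS]mulr_natr -[LHS]mulrA; congr (_ * _)%R.
  have f0 k : (k`!%:R != 0 :> R)%R by rewrite pnatr_eq0 -lt0n fact_gt0.
  have c0 : ('C(n, n./2)%:R != 0 :> R)%R by rewrite pnatr_eq0 -lt0n bin_gt0 {2}e leq_addr.
  by rewrite !natrM; field; rewrite f0 c0.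
have odd0 n : (0 <= (if odd n then 0 else G n./2 / n./2`!%:R ^+ 2)%:E)%E.
  by case: ifP => _; rewrite lee_fin.
rewrite nneseries_esumT// [RHS]nneseries_esumT//.
transitivity (\esum_(n in range double) (G n./2 / n./2`!%:R ^+ 2)%:E).
  rewrite [RHS]esum_mkcond; apply: eq_esum => n _; case: ifPn => on; case: ifPn => //.
    by rewrite inE => -[k _ kn]; move: on; rewrite -kn odd_double.
  rewrite notin_setE => h; exfalso; apply: h; exists n./2 => //.
  by rewrite even_halfK.
rewrite (reindex_esum [set: nat] _ double).
  by apply: eq_esum => n _; rewrite doubleK.
split; first by move=> n _; exists n.
  by move=> i j _ _; exact: double_inj.
by move=> _ [n _ <-]; exists n.
Qed.

End regroup.

(** * Configurations built from holding times *)

Section configurations.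
Variable R : realType.
Implicit Types (e : seq bool) (v : nat -> R) (k n : nat) (t : R).

Definition jump_time v k : R := \sum_(0 <= j < k) v j.

Definition jump_times (u : bool) e v : seq R :=
  [seq jump_time v k.+1 | k <- iota 0 (size e) & nth true e k == u].

Definition spread e v : Prop :=
  (forall k, (k < size e)%N -> 0 < v k) /\ jump_time v (size e) < 1.

(** The jump times of the walk with steps e and holding times v, as a
    configuration. Without the test the pair of finite sets might be a
    configuration by accident, and measurability in v would be less evident. *)
Definition config_of e v : config R :=
  if `[< spread e v >] then
    insubd (Config (is_config0 R))
      ([fset x in jump_times true e v]%fset, [fset x in jump_times false e v]%fset)
  else Config (is_config0 R).

Lemma lt_jump_time v n j k : (forall k, (k < n)%N -> 0 < v k) ->
  (j < k)%N -> (k <= n)%N -> jump_time v j < jump_time v k.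
Proof.
move=> v0 jk kn; rewrite /jump_time (@big_cat_nat _ _ _ j 0 k)//=; last exact: ltnW.
rewrite ltrDl big_ltn//; apply: ltr_pwDl; first by apply: v0; exact: leq_trans kn.
rewrite big_nat_cond; apply: sumr_ge0 => i; rewrite andbT => /andP[_ ik].
by apply/ltW/v0; exact: leq_trans kn.
Qed.

Lemma le_jump_time v n j k : (forall k, (k < n)%N -> 0 < v k) ->
  (j <= k)%N -> (k <= n)%N -> jump_time v j <= jump_time v k.
Proof.
by move=> v0; rewrite leq_eqVlt => /orP[/eqP->//|jk kn]; apply/ltW/(lt_jump_time v0).
Qed.

Lemma jump_time_inj v n : (forall k, (k < n)%N -> 0 < v k) ->
  {in iota 0 n &, injective (fun k => jump_time v k.+1)}.
Proof.
move=> v0 j k; rewrite !mem_iota !add0n /= => jn kn jk.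
case: (ltngtP j k) => // h.
  by have := lt_jump_time v0 (h : (j.+1 < k.+1)%N) kn; rewrite jk ltxx.
by have := lt_jump_time v0 (h : (k.+1 < j.+1)%N) jn; rewrite jk ltxx.
Qed.

Lemma uniq_jump_times u e v : spread e v -> uniq (jump_times u e v).
Proof.
move=> [v0 _]; rewrite map_inj_in_uniq; first by rewrite filter_uniq// iota_uniq.
by move=> j k; rewrite !mem_filter => /andP[_ h1] /andP[_ h2]; exact: (jump_time_inj v0).
Qed.

Lemma size_jump_times u e v : size (jump_times u e v) = count (pred1 u) e.
Proof.
rewrite size_map size_filter -[in RHS](mkseq_nth true e) count_map.
by apply: eq_count.
Qed.

Lemma count_pred1_id e : count (pred1 true) e = count id e.
Proof. by apply: eq_count => -[]. Qed.

Lemma count_pred1_neg e : count (pred1 false) e = count negb e.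
Proof. by apply: eq_count => -[]. Qed.

Lemma card_fset_seq (s : seq R) : uniq s -> #|` [fset x in s]%fset| = size s.
Proof. by move=> us; rewrite card_fseq undup_id. Qed.

Lemma config_ofE e v : balanced e -> spread e v ->
  config_val (config_of e v) =
  ([fset x in jump_times true e v]%fset, [fset x in jump_times false e v]%fset).
Proof.
move=> eb sp; have [v0 v1] := sp.
rewrite /config_of asboolT// val_insubd ifT//; apply/and4P; split => /=.
- apply/allP => x; rewrite !inE => /mapP[k]; rewrite mem_filter mem_iota add0n /= => /andP[_ ke] ->.
  rewrite -(_ : jump_time v 0 = 0); last by rewrite /jump_time big_nil.
  by rewrite (lt_jump_time v0)// (le_lt_trans _ v1)// (le_jump_time v0).
- apply/allP => x; rewrite !inE => /mapP[k]; rewrite mem_filter mem_iota add0n /= => /andP[_ ke] ->.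
  rewrite -(_ : jump_time v 0 = 0); last by rewrite /jump_time big_nil.
  by rewrite (lt_jump_time v0)// (le_lt_trans _ v1)// (le_jump_time v0).
- apply/fdisjointP => x; rewrite !inE => /mapP[k]; rewrite mem_filter => /andP[/eqP ek ki] ->.
  apply/mapP => -[j]; rewrite mem_filter => /andP[/eqP ej ji] jk.
  by move: ek; rewrite (jump_time_inj v0 ki ji jk) ej.
- by rewrite !card_fset_seq ?uniq_jump_times// !size_jump_times count_pred1_id count_pred1_neg.
Qed.

Lemma config_of_degenerate e v : ~ spread e v -> config_of e v = Config (is_config0 R).
Proof. by move=> sp; rewrite /config_of asboolF. Qed.

Lemma card_Up_config_of e v : balanced e -> spread e v ->
  #|` Up (config_of e v)| = (size e)./2.
Proof.
move=> eb sp; rewrite /Up config_ofE//= card_fset_seq ?uniq_jump_times//.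
rewrite size_jump_times count_pred1_id -(count_predC id e) -(eqP eb : _ = count (predC id) e).
by rewrite addnn doubleK.
Qed.

Lemma count_sum_int (T : Type) (P : pred T) (s : seq T) :
  (count P s)%:Z = \sum_(k <- s) (P k : nat)%:Z.
Proof. by elim: s => [|x s IH]; rewrite ?big_nil// big_cons /= PoszD IH. Qed.

Lemma path_config_of e v (t : I01 R) : balanced e -> spread e v ->
  path_fun (config_of e v) t =
  \sum_(0 <= k < size e) (if jump_time v k.+1 <= \val t then jump (nth true e k) else 0).
Proof.
move=> eb sp; rewrite /path_fun /Up /Down config_ofE//=.
have h u : #|` [fset x in [fset x in jump_times u e v]%fset | x <= \val t]%fset|
   = count (fun k => (nth true e k == u) && (jump_time v k.+1 <= \val t)) (iota 0 (size e)).
  rewrite (_ : [fset x in [fset x in jump_times u e v]%fset | x <= \val t]%fset =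
      [fset x in [seq x <- jump_times u e v | x <= \val t]]%fset); last first.
    by apply/fsetP => x; rewrite !inE mem_filter andbC.
  rewrite card_fset_seq ?filter_uniq ?uniq_jump_times// size_filter count_map count_filter.
  by apply: eq_count => k /=; rewrite andbC.
rewrite !h !count_sum_int -sumrB /index_iota subn0; apply: eq_bigr => k _.
by case: nth; case: ifP.
Qed.

Lemma path_config_of_height e v (t : I01 R) c : balanced e -> spread e v ->
  (c <= size e)%N -> jump_time v c <= \val t ->
  ((c < size e)%N -> \val t < jump_time v c.+1) ->
  path_fun (config_of e v) t = height e c.
Proof.
move=> eb sp ce ct tc; rewrite path_config_of//; have [v0 _] := sp.
rewrite (@big_cat_nat _ _ _ c 0)//= [X in _ + X]big_nat_cond [X in _ + X]big1 ?addr0.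
  rewrite big_nat_cond.
  under eq_bigr => k /andP[/andP[_ kc] _].
    rewrite (le_trans _ ct); last by rewrite (le_jump_time v0).
    over.
  rewrite -big_nat_cond /height -[in RHS](mkseq_nth true e) /mkseq -map_take big_map.
  rewrite take_iota /index_iota subn0; congr (\sum_(k <- iota 0 _) _).
  by apply/esym/minn_idPl.
move=> k; rewrite andbT => /andP[ck ke]; rewrite ifF//; apply/negbTE; rewrite -ltNge.
have ce' : (c < size e)%N by exact: leq_ltn_trans ke.
by apply: lt_le_trans (tc ce') _; rewrite (le_jump_time v0).
Qed.

End configurations.

Section spacings.
Variable R : realType.

(** Only the first n coordinates are seen by the generated sigma-algebra, and its
    generators form a pi-system. *)
Definition spacing_boxes (n : nat) : set (set (nat -> R)) :=
  [set A | exists s : nat -> R, A = [set v | forall k, (k < n)%N -> s k < v k]].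

Definition spacings (n : nat) := g_sigma_algebraType (spacing_boxes n).

Lemma measurable_spacing n k : (k < n)%N ->
  measurable_fun [set: spacings n] (fun v : spacings n => (v : nat -> R) k).
Proof.
move=> kn; apply: (measurability (@RGenOInfty.G R)); first exact: RGenOInfty.measurableE.
move=> _ [_ [x ->] <-]; rewrite setTI.
rewrite (_ : _ @^-1` _ = \bigcup_(i in [set: nat])
  [set v : nat -> R | forall j, (j < n)%N -> (if j == k then x else - i%:R) < v j]).
  apply: bigcup_measurable => i _; apply: sub_sigma_algebra.
  by exists (fun j => if j == k then x else - i%:R).
apply/seteqP; split=> v /=.
  rewrite in_itv /= andbT => xv.
  (* A bound on all the coordinates of v at once. *)
  pose i := \sum_(0 <= j < n) (Num.truncn `|v j|).+1.
  exists i => // j jn; case: eqP => [->//|_].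
  rewrite ltrNl; apply: le_lt_trans (_ : `|v j| < i%:R); first by rewrite -normrN ler_norm.
  apply: lt_le_trans (truncnS_gt _) _; rewrite ler_nat /i (big_rem j)/= ?leq_addr//.
  by rewrite mem_index_iota.
by move=> [i _ h]; rewrite in_itv /= andbT; have := h k kn; rewrite eqxx.
Qed.

Lemma measurable_jump_time n k : (k <= n)%N ->
  measurable_fun [set: spacings n] (fun v : spacings n => jump_time (v : nat -> R) k).
Proof.
move=> kn; rewrite (_ : (fun v => _) =
    (fun v : spacings n => \sum_(i < k) (v : nat -> R) i)); last first.
  by apply/funext => v; rewrite /jump_time big_mkord.
by apply: measurable_sum => j; apply: measurable_spacing; exact: leq_trans kn.
Qed.

Lemma measurable_spread (e : seq bool) :
  measurable [set v : spacings (size e) | spread e v].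
Proof.
rewrite (_ : [set v | _] = (\bigcap_(k in `I_(size e)) [set v : spacings (size e) | 0 < (v : nat -> R) k])
   `&` [set v : spacings (size e) | jump_time (v : nat -> R) (size e) < 1]); last first.
  by apply/seteqP; split=> v [h1 h2]; (split; [exact: h1|exact: h2]).
apply: measurableI; last by apply: measurable_set_lt; exact: measurable_jump_time.
by apply: bigcap_measurableType => k /= ke; apply: measurable_set_gt; exact: measurable_spacing.
Qed.

(** At a fixed time the path is a finite sum of indicators of events on the jump
    times. *)
Lemma measurable_path_of_config_of (e : seq bool) : balanced e ->
  measurable_fun [set: spacings (size e)] (fun v : spacings (size e) => path_of (config_of e v)).
Proof.
move=> eb; apply: (measurability (@evaluation_events R)) => //.
move=> _ [_ [t [k ->]] <-]; rewrite setTI.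
pose f (v : spacings (size e)) : R := \sum_(i < size e)
  (jump (nth true e i))%:~R * \1_[set v : spacings (size e) | jump_time (v : nat -> R) i.+1 <= \val t] v.
have mf : measurable_fun setT f.
  apply: measurable_sum => i; apply: measurable_funM => //.
  by apply: measurable_indic; apply: measurable_set_le; exact: measurable_jump_time.
have fE v : spread e v -> f v = (path_fun (config_of e v) t)%:~R.
  move=> sp; rewrite path_config_of// /f big_mkord rmorph_sum /=.
  apply: eq_bigr => i _; rewrite indicE; case: ifPn => h.
    by rewrite mem_set// mulr1.
  by rewrite memNset ?mulr0//= => h'; rewrite h' in h.
rewrite (_ : _ @^-1` _ = ([set v : spacings (size e) | spread e v] `&` f @^-1` [set k%:~R])
   `|` (~` [set v : spacings (size e) | spread e v] `&`
        [set _ : spacings (size e) | path_fun (Config (is_config0 R)) t = k])).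
  have mS := @measurable_spread e.
  apply: measurableU; apply: measurableI => //.
  - by rewrite -[X in measurable X]setTI; exact: mf.
  - exact: measurableC.
  - have [h|h] := pselect (path_fun (Config (is_config0 R)) t = k).
      by rewrite (_ : [set _ | _] = setT)//; apply/seteqP; split.
    by rewrite (_ : [set _ | _] = set0)//; apply/seteqP; split.
apply/seteqP; split=> v /=.
  have [sp|sp] := pselect (spread e v) => h; first by left; split=> //; rewrite fE// h.
  by right; split=> //; rewrite -h config_of_degenerate.
case=> -[sp]; last by rewrite config_of_degenerate.
by rewrite fE// => /eqP; rewrite eqr_int => /eqP.
Qed.

Lemma measurable_config_of (e : seq bool) : balanced e ->
  measurable_fun [set: spacings (size e)]
    (fun v : spacings (size e) => config_of e v : config R).
Proof.
move=> eb _ A [B mB <-]; rewrite !setTI.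
by have := measurable_path_of_config_of eb measurableT mB; rewrite setTI.
Qed.

End spacings.

(** * Lipschitz functions on configurations *)

Section lipschitz.
Variable R : realType.
Implicit Types (U V : config R) (f : config R -> R).

Definition empty_config : config R := Config (is_config0 R).

Lemma remove_pair U r s : r \in Up U -> s \in Down U ->
  exists V, [/\ neighbours U V & #|` Up U| = #|` Up V|.+1].
Proof.
move=> rU sU; have /and4P[u1 u2 u3 u4] := configP U.
have rs : r != s.
  by apply/eqP => rs; have := fdisjointP u3 r rU; rewrite rs sU.
have Uc : #|` Up U| = #|` (Up U `\ r)%fset|.+1 by rewrite (cardfsD1 r) rU.
have Dc : #|` Down U| = #|` (Down U `\ s)%fset|.+1 by rewrite (cardfsD1 s) sU.
have vV : is_config ((Up U `\ r)%fset, (Down U `\ s)%fset).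
  apply/and4P; split => /=.
  - by apply/allP => x; rewrite !inE => /andP[_ xU]; exact: (allP u1).
  - by apply/allP => x; rewrite !inE => /andP[_ xU]; exact: (allP u2).
  - apply/fdisjointP => x; rewrite !inE => /andP[_ xU].
    by rewrite negb_and (fdisjointP u3)// orbT.
  - by rewrite -eqSS -Uc -Dc.
exists (Config vV); split => //; split.
  by move=> UV; move: Uc; rewrite {1}UV /Up /= => /n_Sn.
exists (r, s); first by split=> //=; [exact: (allP u1)|exact: (allP u2)].
apply: val_inj; rewrite /Psi /= val_insubd /Psi_pair /= !inE !eqxx /=.
rewrite !fsetD1K//=.
have eU : (Up U, Down U) = config_val U by rewrite /Up /Down -surjective_pairing.
by rewrite eU configP.
Qed.

Lemma gdist_neighbours U V : neighbours U V -> (gdist U V <= 1)%E.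
Proof.
move=> UV; apply: ereal_inf_lbound; exists 1%N => //.
by exists (fun k => if k == 0%N then U else V); split=> // -[|].
Qed.

(** The graph distance to the empty configuration is at most the number of pairs
    of jumps, which can be removed one by one. *)
Lemma Lip1_le_card f U : Lip1 f -> `|f U - f empty_config| <= #|` Up U|%:R.
Proof.
move=> [_ fl]; have [n] := ubnP #|` Up U|; elim: n U => // n IH U; rewrite ltnS => Un.
have /and4P[u1 u2 u3 u4] := configP U.
have [U0|[r rU]] := fset_0Vmem (Up U).
  have D0 : Down U = fset0.
    by apply/eqP; rewrite -cardfs_eq0 -(eqP u4) -/(Up U) U0 cardfs0.
  suff -> : U = empty_config by rewrite subrr normr0 ler0n.
  by apply: val_inj => /=; rewrite [LHS]surjective_pairing -/(Up U) -/(Down U) U0 D0.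
have [D0|[s sU]] := fset_0Vmem (Down U).
  by move: rU; move: u4; rewrite -/(Up U) -/(Down U) D0 cardfs0 cardfs_eq0 => /eqP ->.
have [V [UV cUV]] := remove_pair rU sU.
have h1 : `|f U - f V| <= 1.
  by rewrite -lee_fin; exact: le_trans (fl U V) (gdist_neighbours UV).
have h2 : `|f V - f empty_config| <= #|` Up V|%:R by apply: IH; rewrite -ltnS -cUV ltnS.
have -> : f U - f empty_config = (f V - f empty_config) + (f U - f V) by ring.
by rewrite cUV -natr1; apply: le_trans (ler_normD _ _) _; rewrite lerD.
Qed.

Lemma Lip1_config_of f (e : seq bool) (v : nat -> R) : Lip1 f -> balanced e ->
  `|f (config_of e v) - f empty_config| <= (size e)./2%:R.
Proof.
move=> fl eb; have [sp|sp] := pselect (spread e v).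
  by apply: le_trans (Lip1_le_card _ fl) _; rewrite card_Up_config_of.
by rewrite config_of_degenerate// subrr normr0 ler0n.
Qed.

End lipschitz.

(** * Decomposition of a walk by its steps before time 1 *)

Lemma nneseries_EFin (R : realType) (u : nat -> R) : cvgn (series u) ->
  (\sum_(n <oo) (u n)%:E = (limn (series u))%:E)%E.
Proof.
move=> cu; rewrite -EFin_lim//; congr (limn _).
by apply/funext => n /=; rewrite sumEFin.
Qed.

Section walk_decomposition.
Context (R : realType) d (Omega : measurableType d) (Pr : probability Omega R)
  (Y : nat -> Omega -> int) (S : nat -> Omega -> R).
Variables (a b : int -> R) (kappa : R).
Hypothesis a0 : forall j, 0 < a j.
Hypothesis b0 : forall j, 0 < b j.
Hypothesis ab : forall j, a j + b j = kappa.
Hypothesis YS : jump_chain_holding_times a b Pr Y S.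

Let mY n j : measurable [set w | Y n w = j]. Proof. by case: YS. Qed.
Let mS n : measurable_fun [set: Omega] (S n). Proof. by case: YS. Qed.

Let kappa0 : 0 < kappa. Proof. by rewrite -(ab 0) addr_gt0. Qed.

Definition start_mass : R := fine (Pr [set w | Y 0%N w = 0]).

Lemma start_massE : Pr [set w | Y 0%N w = 0] = start_mass%:E.
Proof. by rewrite /start_mass fineK// fin_num_measure. Qed.

Lemma start_mass_ge0 : 0 <= start_mass.
Proof. by rewrite /start_mass fine_ge0. Qed.

Definition chain_event (e : seq bool) : set Omega :=
  [set w | forall k, (k <= size e)%N -> Y k w = height e k].

Definition jump_event e : set Omega := chain_event e `&` exact_jumps S (size e) 1.

Lemma measurable_chain_event e : measurable (chain_event e).
Proof.
have -> : chain_event e = \bigcap_(k in `I_(size e).+1) [set w | Y k w = height e k].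
  by apply/seteqP; split=> w /=.
by apply: bigcap_measurableType => k _; exact: mY.
Qed.

Lemma measurable_jump_event e : measurable (jump_event e).
Proof.
by apply: measurableI; [exact: measurable_chain_event|exact: measurable_exact_jumps].
Qed.

Lemma jump_prob_word e k : (k < size e)%N ->
  jump_prob a b (height e k) (height e k.+1) =
  (if nth true e k then a else b) (height e k) / kappa.
Proof.
move=> ke; rewrite /jump_prob heightS// !ab; case: nth => /=; first by rewrite eqxx.
by rewrite ifF ?eqxx//; apply/negbTE/eqP => /addrI.
Qed.

Lemma prod_jump_prob_word e :
  \prod_(0 <= k < size e) jump_prob a b (height e k) (height e k.+1) =
  weight a b e / kappa ^+ size e.
Proof.
rewrite (eq_big_nat _ _ (F2 := fun k => (if nth true e k then a else b) (height e k) * kappa^-1)).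
  by rewrite big_split /= prodr_const_nat subn0 exprVn.
by move=> k /andP[_ ke]; exact: jump_prob_word.
Qed.

Lemma chain_event_exponential e :
  exponential_on Pr S kappa (chain_event e) (size e).+1
    (start_mass * (weight a b e / kappa ^+ size e)).
Proof.
move=> s s0; have [_ _ /(_ (size e) (height e) s s0) H] := YS.
have -> : chain_event e `&` box S (size e).+1 s =
    [set w | forall k, (k <= size e)%N -> Y k w = height e k /\ s k < S k w].
  apply/seteqP; split=> w /=; first by move=> [h1 h2] k ke; split; [exact: h1|exact: h2].
  by move=> h; split=> k ke; have [] := h k ke.
apply: (etrans H).
rewrite height0 start_massE prod_jump_prob_word -EFinM; congr EFin.
rewrite -[RHS]mulrA; congr (_ * (_ * _)); apply: eq_bigr => k _.
by rewrite ab.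
Qed.

Let c_ge0 e : 0 <= start_mass * (weight a b e / kappa ^+ size e).
Proof.
by rewrite mulr_ge0 ?start_mass_ge0// divr_ge0 ?exprn_ge0 ?ltW// weight_gt0.
Qed.

(** The jump chain contributes weight / kappa ^ n and the holding times
    kappa ^ n * exp (- kappa): the powers of kappa cancel, and what is left of
    the rates does not involve s. *)
Lemma jump_event_box_law e (s : nat -> R) :
  Pr (jump_event e `&` box S (size e) s) =
  (start_mass * expR (- kappa) * weight a b e *
   (Num.max 0 (1 - \sum_(0 <= k < size e) Num.max 0 (s k)) ^+ size e / (size e)`!%:R))%:E.
Proof.
apply: (etrans (exact_jumps_box_law (ltW kappa0) s mS (measurable_chain_event e) (c_ge0 e)
  ltr01 (@chain_event_exponential e))); congr EFin.
congr (_ * _); rewrite mulr1.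
by field; rewrite expf_neq0 ?gt_eqF.
Qed.

Lemma jump_event_law e :
  Pr (jump_event e) = (start_mass * expR (- kappa) * weight a b e / (size e)`!%:R)%:E.
Proof.
rewrite [LHS](_ : _ = Pr (jump_event e `&` box S (size e) (fun=> 0))).
  rewrite jump_event_box_law big1 ?subr0; last by move=> k _; rewrite max_l.
  by rewrite (_ : Num.max 0 1 = 1 :> R) ?expr1n ?mulrA ?mulr1 ?mul1r// max_r// ler01.
congr (Pr _); apply/esym/setIidl => w [_ [bw _]] k ke; exact: bw (ltnW ke).
Qed.

Definition word_event (F : seq bool -> set Omega) (k : nat) : set Omega :=
  oapp F set0 (pickle_inv k).

Lemma measure_word_event F (m : {measure set Omega -> \bar R}) k :
  m (word_event F k) = oapp (m \o F) 0%E (pickle_inv k).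
Proof. by rewrite /word_event; case: pickle_inv => //=; rewrite measure0. Qed.

Lemma trivIset_jump_event : trivIset setT (word_event jump_event).
Proof.
have h (i j : nat) (e e' : seq bool) w : jump_event e w -> jump_event e' w -> e = e'.
  wlog ee : e e' / (size e <= size e')%N.
    move=> H h1 h2; case: (leqP (size e) (size e')) => ee; first exact: H.
    by apply/esym/H => //; exact: ltnW.
  move=> [c1 [bw1 /andP[_ h1]]] [c2 [bw2 /andP[h2 _]]].
  (* A longer word would have a jump more before time 1. *)
  have se : size e = size e'.
    apply/eqP; rewrite eqn_leq ee /= leqNgt; apply/negP => lt.
    have := lt_trans h2 h1; rewrite ltNge => /negP; apply.
    apply: (@le_jump_time _ (fun k => S k w) (size e')) => // k kn.
    exact: bw2 (ltnW kn).
  apply: (@eq_from_nth _ true) => // k ke.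
  have := c1 k.+1 ke; have := c1 k (ltnW ke).
  rewrite c2 ?(leq_trans (ltnW ke))// c2 -?se// => e1.
  rewrite !heightS -?se// e1 => /addrI; by case: nth; case: nth.
apply/trivIsetP => i j _ _ ij; apply/seteqP; split=> w // -[].
rewrite /word_event; have := @pickle_invK (seq bool) i; have := @pickle_invK (seq bool) j.
case: (pickle_inv j) => [e'|//] /= ej; case: (pickle_inv i) => [e|//] /= ei.
by move=> h1 h2; move: ij; rewrite -ei -ej (h i j _ _ _ h1 h2) eqxx.
Qed.

Let measurable_word_event F : (forall e, measurable (F e)) ->
  forall k, measurable (word_event F k).
Proof.
by move=> mF k; rewrite /word_event; case: pickle_inv => [e|]; [exact: mF|exact: measurable0].
Qed.

(** The masses of the jump events are Poisson weights spread over the words of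
    each length, and add up to the mass of the start at 0. This excludes at once
    explosions, zero holding times, steps other than +1 and -1, and jumps at time
    1. *)
Lemma negligible_no_jump_event :
  Pr.-negligible ([set w | Y 0%N w = 0] `\` \bigcup_k word_event jump_event k).
Proof.
have mE := measurable_word_event measurable_jump_event.
have mU : measurable (\bigcup_k word_event jump_event k) by exact: bigcup_measurable.
have EU : \bigcup_k word_event jump_event k `<=` [set w | Y 0%N w = 0].
  move=> w [k _]; rewrite /word_event; case: pickle_inv => //= e [/(_ 0%N (leq0n _))].
  by rewrite height0.
have PU : Pr (\bigcup_k word_event jump_event k) = start_mass%:E.
  rewrite measure_semi_bigcup//; last exact: trivIset_jump_event.
  under eq_eseriesr do rewrite measure_word_event.
  rewrite nneseries_words; last by move=> e /=.
  transitivity (\sum_(n <oo) (start_mass * expR (- kappa) * (kappa ^+ n / n`!%:R))%:E)%E.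
    apply: eq_eseriesr => n _.
    rewrite (eq_big_seq (fun e => (start_mass * expR (- kappa) / n`!%:R * weight a b e)%:E)).
      rewrite sumEFin -mulr_sumr (sum_weight_words n ab); congr EFin; ring.
    move=> e; rewrite mem_words => /eqP <-; rewrite /= jump_event_law; congr EFin; ring.
  under eq_eseriesr do rewrite EFinM.
  rewrite nneseriesZl; last first.
    by move=> n _; rewrite lee_fin divr_ge0// exprn_ge0// ltW.
  rewrite (_ : (\sum_(n <oo) (kappa ^+ n / n`!%:R)%:E)%E = (expR kappa)%:E).
    by rewrite -EFinM -mulrA mulrC [expR (- _) * _]mulrC expRxMexpNx_1 mul1r.
  have := nneseries_EFin (is_cvg_series_exp_coeff kappa); rewrite -/(expR kappa) => <-.
  by apply: eq_eseriesr => n _; rewrite /exp_coeff /=.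
apply/negligibleP; first exact: measurableD.
by apply: (etrans (measure_setD (mY 0%N 0) mU EU start_massE PU)); rewrite subrr.
Qed.

Lemma negligible_zero_holding : Pr.-negligible [set w | S 0%N w <= 0].
Proof.
rewrite (_ : [set w | _] = \bigcup_k (oapp (fun j : int => [set w | Y 0%N w = j /\ S 0%N w <= 0])
    set0 (pickle_inv k))); last first.
  apply/seteqP; split=> w; last by move=> [k _]; case: pickle_inv => // j [].
  have [k kE] : exists k, pickle_inv k = Some (Y 0%N w).
    by exists (choice.pickle (Y 0%N w)); exact: pickleK_inv.
  by move=> Sw; exists k => //; rewrite kE.
apply: negligible_bigcup => k; case: pickle_inv => [j|] /=; last exact: negligible_set0.
have mj : measurable [set w | Y 0%N w = j /\ 0 < S 0%N w].
  exact: (measurableI _ _ (mY 0%N j) (measurable_set_gt 0 (mS 0%N))).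
have [_ _ /(_ 0%N (fun=> j) (fun=> 0) (fun=> lexx _)) H] := YS.
have {}H : Pr [set w | Y 0%N w = j /\ 0 < S 0%N w] = Pr [set w | Y 0%N w = j].
  rewrite [RHS](_ : _ = Pr [set w | Y 0%N w = j] * 1)%E; last by rewrite mule1.
  rewrite big_nil big_nat1 mulr0 oppr0 expR0 mulr1 in H.
  rewrite -H; congr (Pr _); apply/seteqP; split=> w /=.
    by move=> h i; rewrite leqn0 => /eqP ->.
  by move=> /(_ 0%N (leqnn _)).
have Pj : Pr [set w | Y 0%N w = j] = (fine (Pr [set w | Y 0%N w = j]))%:E.
  by rewrite fineK// fin_num_measure.
rewrite (_ : [set w | _] = [set w | Y 0%N w = j] `\` [set w | Y 0%N w = j /\ 0 < S 0%N w]).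
  have sub : [set w | Y 0%N w = j /\ 0 < S 0%N w] `<=` [set w | Y 0%N w = j] by move=> w [].
  apply/negligibleP; first exact: measurableD.
  by apply: (etrans (measure_setD (mY 0%N j) mj sub Pj (etrans H Pj))); rewrite subrr.
apply/seteqP; split=> w /=.
  by move=> [-> Sw]; split=> // -[_]; rewrite ltNge Sw.
by move=> [-> h]; split=> //; rewrite leNgt; apply/negP => h'; apply: h.
Qed.

End walk_decomposition.

Lemma cadlag_eq (R : realType) (x y : cadlag R) : (forall t, x t = y t) -> x = y.
Proof.
case: x y => [x px] [y py] /= /funext xy; move: px py; rewrite xy => px py.
by congr Cadlag; exact: Prop_irrelevance.
Qed.

Lemma measurable_evaluation (R : realType) (t : I01 R) (k : int) :
  measurable [set x : cadlag R | x t = k].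
Proof. by apply: sub_sigma_algebra; exists t, k. Qed.

Lemma measurable_bridge_event (R : realType) : measurable (@bridge_event R).
Proof. by apply: measurableI; exact: measurable_evaluation. Qed.

Lemma jump_time_bracket (R : realType) (v : nat -> R) (n : nat) (t : R) :
  0 <= t -> t < jump_time v n.+1 ->
  exists c, [/\ (c <= n)%N, jump_time v c <= t & t < jump_time v c.+1].
Proof.
move=> t0; elim: n => [|n IH] tn.
  by exists 0%N; split=> //; rewrite /jump_time big_nil.
have [/IH[c [cn h1 h2]]|h] := ltP t (jump_time v n.+1).
  by exists c; split=> //; exact: ltnW.
by exists n.+1.
Qed.

Section bridge_decomposition.
Context (R : realType) d (Omega : measurableType d) (Pr : probability Omega R)
  (Y : nat -> Omega -> int) (S : nat -> Omega -> R) (X : Omega -> cadlag R)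
  (P : probability (cadlag R) R).
Variables (a b : int -> R) (kappa : R).
Hypothesis a0 : forall j, 0 < a j.
Hypothesis b0 : forall j, 0 < b j.
Hypothesis ab : forall j, a j + b j = kappa.
Hypothesis YS : jump_chain_holding_times a b Pr Y S.
Hypothesis mX : measurable_fun [set: Omega] X.
Hypothesis XYS : {ae Pr, forall w, forall (n : nat) (t : I01 R),
  \sum_(0 <= k < n) S k w <= \val t < \sum_(0 <= k < n.+1) S k w -> X w t = Y n w}.
Hypothesis PX : forall A : set (cadlag R), measurable A -> P A = Pr (X @^-1` A).

Let mY n j : measurable [set w | Y n w = j]. Proof. by case: YS. Qed.
Let mS n : measurable_fun [set: Omega] (S n). Proof. by case: YS. Qed.

Definition spacings_of n (w : Omega) : spacings R n := fun k => S k w.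

Lemma measurable_spacings_of n : measurable_fun [set: Omega] (spacings_of n).
Proof.
apply: (@measurability _ _ Omega (spacings R n) setT (@spacings_of n) (@spacing_boxes R n)) => //.
move=> _ [_ [s ->] <-].
by rewrite setTI; exact: (measurable_box mS).
Qed.

Definition jump_config e (w : Omega) : config R := config_of e (fun k => S k w).

Lemma measurable_jump_config e : balanced e ->
  measurable_fun [set: Omega] (jump_config e).
Proof.
move=> eb.
exact: (measurableT_comp (@measurable_config_of R e eb) (@measurable_spacings_of (size e))).
Qed.

Lemma jump_event_spread e w : jump_event Y S e w -> spread e (fun k => S k w).
Proof.
by move=> [_ [bw /= /andP[h _]]]; split=> // k ke; exact: bw (ltnW ke).
Qed.

Lemma eq_measure_off_null (A B Z : set Omega) :
  measurable A -> measurable B -> measurable Z -> Pr Z = 0 ->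
  (forall w, ~ Z w -> A w <-> B w) -> Pr A = Pr B.
Proof.
move=> mA mB mZ Z0 AB.
have drop C : measurable C -> Pr C = Pr (C `\` Z).
  move=> mC; rewrite (measureDI Pr mC mZ).
  rewrite [X in (_ + X)%E](_ : _ = 0%E) ?adde0//.
  apply/eqP; rewrite -measure_le0 -Z0.
  by apply: le_measure; rewrite ?inE//; exact: measurableI.
rewrite (drop _ mA) (drop _ mB); congr (Pr _).
by apply/seteqP; split=> w [h nZ]; split=> //; apply/AB.
Qed.

Lemma regular_paths : exists Z : set Omega, [/\ measurable Z, Pr Z = 0 &
  forall w, ~ Z w -> [/\ forall (n : nat) (t : I01 R),
      \sum_(0 <= k < n) S k w <= \val t < \sum_(0 <= k < n.+1) S k w -> X w t = Y n w,
    0 < S 0%N w &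
    Y 0%N w = 0 -> exists k, word_event (jump_event Y S) k w]].
Proof.
have [A [mA A0 HA]] := XYS; have [N [mN N0 HN]] := negligible_zero_holding YS.
have [M [mM M0 HM]] := negligible_no_jump_event a0 b0 ab YS.
exists (A `|` N `|` M); split.
- by do 2 apply: measurableU => //.
- apply/negligibleP; first by do 2 apply: measurableU => //.
  by do 2 (try apply: negligibleU); exact/negligibleP.
move=> w nZ; split.
- by apply: contrapT => h; apply: nZ; left; left; exact: HA.
- rewrite ltNge; apply/negP => h; apply: nZ; left; right; exact: HN.
- move=> Y0; apply: contrapT => h; apply: nZ; right; apply: HM; split=> //.
  by move=> [k _ wk]; apply: h; exists k.
Qed.

Let measurable_preX B : measurable B -> measurable (X @^-1` B).
Proof. by move=> mB; rewrite -[X in measurable X]setTI; exact: mX. Qed.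

Lemma X_at0 w : (forall (n : nat) (t : I01 R),
    \sum_(0 <= k < n) S k w <= \val t < \sum_(0 <= k < n.+1) S k w -> X w t = Y n w) ->
  0 < S 0%N w -> X w (I01_0 R) = Y 0%N w.
Proof.
by move=> h S0; apply: h; rewrite big_nil big_nat1 /= lexx.
Qed.

Lemma start_event_mass : P (@start_event R) = Pr [set w | Y 0%N w = 0].
Proof.
have m0 : measurable (@start_event R) by exact: measurable_evaluation.
rewrite PX//; have [Z [mZ Z0 HZ]] := regular_paths.
apply: (eq_measure_off_null _ _ mZ Z0) => //; first exact: measurable_preX.
by move=> w /HZ[h1 h2 _]; rewrite /start_event /= (X_at0 h1 h2).
Qed.

(** Both paths are constant between successive jump times, where they take the
    same heights. *)
Lemma path_on_jump_event e w : jump_event Y S e w -> balanced e ->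
  (forall (n : nat) (t : I01 R),
    \sum_(0 <= k < n) S k w <= \val t < \sum_(0 <= k < n.+1) S k w -> X w t = Y n w) ->
  X w = path_of (jump_config e w).
Proof.
move=> Ew eb h; have sp := jump_event_spread Ew.
case: Ew => cw [bw /= /andP[_ w1]].
apply: cadlag_eq => t; have /andP[t0 t1] := valP t.
have [c [ce ct tc]] := jump_time_bracket (v := fun k => S k w) t0 (le_lt_trans t1 w1).
rewrite (h c t); last by apply/andP; split.
rewrite cw//; apply/esym; apply: path_config_of_height => //.
Qed.

Lemma bridge_jump_event e w : jump_event Y S e w ->
  (forall (n : nat) (t : I01 R),
    \sum_(0 <= k < n) S k w <= \val t < \sum_(0 <= k < n.+1) S k w -> X w t = Y n w) ->
  bridge_event (X w) <-> balanced e.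
Proof.
move=> [cw [bw /= /andP[w0 w1]]] h.
have X1 : X w (I01_1 R) = height e (size e).
  by rewrite -cw//; apply: h; rewrite /= (ltW w0).
rewrite /bridge_event /= X1 (X_at0 h (bw 0%N isT)) cw// height0 balancedE.
by split=> [[_ ->]//|/eqP ->].
Qed.

(** The bridge event is, up to a null set, the disjoint union of the jump events
    of the balanced words. *)
Lemma bridge_decomposition B : measurable B ->
  P (B `&` @bridge_event R) =
  balanced_sum (fun e => Pr (jump_event Y S e `&` jump_config e @^-1` (@path_of R @^-1` B))).
Proof.
move=> mB; have mBr : measurable (B `&` @bridge_event R).
  by apply: measurableI => //; exact: measurable_bridge_event.
rewrite PX//; have [Z [mZ Z0 HZ]] := regular_paths.
have mE e := measurable_jump_event YS e.
pose G k : set Omega := word_event (jump_event Y S) k `&` X @^-1` (B `&` @bridge_event R).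
have mG k : measurable (G k).
  apply: measurableI; last exact: measurable_preX.
  by rewrite /word_event; case: pickle_inv => [e|]; [exact: mE|exact: measurable0].
transitivity (Pr (\bigcup_k G k)).
  apply: (eq_measure_off_null _ _ mZ Z0); first exact: measurable_preX.
    exact: bigcup_measurable.
  move=> w nZ; split; last by move=> [k _ []].
  move=> Bw; have [h1 h2 h3] := HZ w nZ.
  have Y0 : Y 0%N w = 0 by rewrite -(X_at0 h1 h2); case: Bw => _ [].
  by have [k wk] := h3 Y0; exists k.
rewrite measure_semi_bigcup//; last 2 first.
- exact: trivIset_setIr (@trivIset_jump_event _ _ _ _ _).
- exact: bigcup_measurable.
rewrite /balanced_sum; apply: eq_eseriesr => k _.
rewrite /G /word_event; case: pickle_inv => [e|]/=; last by rewrite set0I measure0.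
have [eb|eb] := boolP (balanced e).
  apply: (eq_measure_off_null _ _ mZ Z0).
  - by apply: measurableI => //; exact: measurable_preX.
  - apply: measurableI => //; rewrite -[X in measurable X]setTI.
    by apply: (measurable_jump_config eb) => //; exists B => //; rewrite setTI.
  move=> w nZ; have [h1 _ _] := HZ w nZ.
  split=> -[Ew]; have XE := path_on_jump_event Ew eb h1.
    by rewrite /= XE => -[].
  rewrite /= -XE => Bw; split=> //; split=> //.
  exact/(bridge_jump_event Ew h1).
rewrite -(measure0 Pr); apply: (eq_measure_off_null _ _ mZ Z0) => //.
  by apply: measurableI => //; exact: measurable_preX.
move=> w nZ; have [h1 _ _] := HZ w nZ; split=> // -[Ew [_ Bw]].
by move: eb; rewrite (iffLR (bridge_jump_event Ew h1) Bw).
Qed.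

End bridge_decomposition.

(** * Bridges as mixtures *)

Lemma scaled_pushforward d1 d2 (T1 : measurableType d1) (T2 : measurableType d2) (R : realType)
    (m : {measure set T1 -> \bar R}) (E : set T1) (f : T1 -> T2) (c : R) :
  measurable E -> measurable_fun [set: T1] f -> 0 <= c ->
  exists j : {measure set T2 -> \bar R},
    forall A, j A = (c%:E * m (E `&` f @^-1` A))%E.
Proof.
move=> mE mf c0.
unshelve refine (ex_intro _
  (mscale (NngNum c0) (pushforward (mrestr m mE) f) : {measure set T2 -> \bar R}) _) => //.
move=> A.
by rewrite /mscale /= /pushforward /mrestr setIC.
Qed.

Section proportional.
Variable R : realType.

Lemma setI_closed_spacing_boxes n : setI_closed (@spacing_boxes R n).
Proof.
move=> _ _ [s ->] [s' ->]; exists (fun k => Num.max (s k) (s' k)).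
apply/seteqP; split=> v /=.
  by move=> [h h'] k kn; rewrite gt_max h ?h'.
by move=> h; split=> k kn; have := h k kn; rewrite gt_max => /andP[].
Qed.

(** Given the jump event, the holding times have the same law for all walks of
    constant total jump rate: on boxes this is [jump_event_box_law], and the boxes
    are a generating pi-system. *)
Lemma jump_event_proportional
  d1 (Omega1 : measurableType d1) (Pr1 : probability Omega1 R) Y1 S1 (a1 b1 : int -> R) kappa1
  d2 (Omega2 : measurableType d2) (Pr2 : probability Omega2 R) Y2 S2 (a2 b2 : int -> R) kappa2 :
  (forall j, 0 < a1 j) -> (forall j, 0 < b1 j) -> (forall j, a1 j + b1 j = kappa1) ->
  jump_chain_holding_times a1 b1 Pr1 Y1 S1 ->
  (forall j, 0 < a2 j) -> (forall j, 0 < b2 j) -> (forall j, a2 j + b2 j = kappa2) ->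
  jump_chain_holding_times a2 b2 Pr2 Y2 S2 ->
  forall e (A : set (config R)), balanced e -> measurable A ->
  ((start_mass Pr2 Y2 * expR (- kappa2) * weight a2 b2 e)%:E *
     Pr1 (jump_event Y1 S1 e `&` jump_config S1 e @^-1` A) =
   (start_mass Pr1 Y1 * expR (- kappa1) * weight a1 b1 e)%:E *
     Pr2 (jump_event Y2 S2 e `&` jump_config S2 e @^-1` A))%E.
Proof.
move=> a10 b10 ab1 YS1 a20 b20 ab2 YS2 e A eb mA.
have C_ge0 d (Omega : measurableType d) (Pr : probability Omega R) Y a b kappa :
    (forall j, 0 < a j) -> (forall j, 0 < b j) ->
    0 <= start_mass Pr Y * expR (- kappa) * weight a b e.
  move=> a0 b0; rewrite !mulr_ge0 ?start_mass_ge0 ?expR_ge0//.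
  exact/ltW/weight_gt0.
have [j1 E1] := scaled_pushforward Pr1 (measurable_jump_event YS1 e)
  (@measurable_spacings_of _ _ _ _ _ _ _ _ YS1 (size e)) (C_ge0 _ _ Pr2 Y2 a2 b2 kappa2 a20 b20).
have [j2 E2] := scaled_pushforward Pr2 (measurable_jump_event YS2 e)
  (@measurable_spacings_of _ _ _ _ _ _ _ _ YS2 (size e)) (C_ge0 _ _ Pr1 Y1 a1 b1 kappa1 a10 b10).
pose V : set (spacings R (size e)) :=
  (fun v : spacings R (size e) => config_of e v : config R) @^-1` A.
have mV : measurable V.
  by rewrite -[V]setTI; exact: (@measurable_config_of R e eb).
have -> : jump_config S1 e @^-1` A = spacings_of S1 (size e) @^-1` V by [].
have -> : jump_config S2 e @^-1` A = spacings_of S2 (size e) @^-1` V by [].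
rewrite -E1 -E2.
pose g (i : nat) : set (nat -> R) := [set v | forall k, (k < size e)%N -> - i%:R < v k].
apply: (@g_sigma_algebra_measure_unique _ R (spacings R (size e)) (@spacing_boxes R (size e)) _ g).
- by move=> B; exact: sub_sigma_algebra.
- by move=> i; exists (fun=> - i%:R).
- apply/seteqP; split=> v // _.
  pose i := (\sum_(0 <= j < size e) (Num.truncn `|(v : nat -> R) j|).+1)%N.
  exists i => // k kn; rewrite ltrNl.
  apply: le_lt_trans (_ : `|(v : nat -> R) k| < i%:R); first by rewrite -normrN ler_norm.
  apply: lt_le_trans (truncnS_gt _) _; rewrite ler_nat /i (big_rem k)/= ?leq_addr//.
  by rewrite mem_index_iota.
- exact: setI_closed_spacing_boxes.
- move=> _ [s ->]; rewrite E1 E2.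
  have H1 := jump_event_box_law a10 b10 ab1 YS1 e s.
  have H2 := jump_event_box_law a20 b20 ab2 YS2 e s.
  rewrite [X in (_ * X)%E](H1 : Pr1 (_ `&` _) = _) [X in _ = (_ * X)%E](H2 : Pr2 (_ `&` _) = _).
  by rewrite -!EFinM; congr EFin; ring.
- move=> i; rewrite E1.
  apply: lte_mul_pinfty => //; first by rewrite lee_fin; exact: C_ge0.
  rewrite ltey_eq fin_num_measure//; apply: measurableI.
    exact: (measurable_jump_event YS1 e).
  rewrite -[X in measurable X]setTI.
  apply: (@measurable_spacings_of _ _ _ _ _ _ _ _ YS1 (size e)) => //.
  by apply: sub_sigma_algebra; exists (fun=> - i%:R).
- exact: mV.
Qed.

End proportional.

Section mixture.
Context (R : realType) d (Omega : measurableType d) (Pr : probability Omega R)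
  (Y : nat -> Omega -> int) (S : nat -> Omega -> R) (X : Omega -> cadlag R)
  (P : probability (cadlag R) R).
Variables (a b : int -> R) (kappa : R).
Hypothesis a0 : forall j, 0 < a j.
Hypothesis b0 : forall j, 0 < b j.
Hypothesis ab : forall j, a j + b j = kappa.
Hypothesis YS : jump_chain_holding_times a b Pr Y S.
Hypothesis mX : measurable_fun [set: Omega] X.
Hypothesis XYS : {ae Pr, forall w, forall (n : nat) (t : I01 R),
  \sum_(0 <= k < n) S k w <= \val t < \sum_(0 <= k < n.+1) S k w -> X w t = Y n w}.
Hypothesis PX : forall A : set (cadlag R), measurable A -> P A = Pr (X @^-1` A).
Hypothesis start_gt0 : (0 < P (@start_event R))%E.

Variable m : probability (config R) R.
Hypothesis mP : is_bridge_law P m.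
Variable j : seq bool -> {measure set config R -> \bar R}.
Hypothesis jE : forall e A, balanced e -> measurable A ->
  Pr (jump_event Y S e `&` jump_config S e @^-1` A) =
  ((start_mass Pr Y * expR (- kappa) * weight a b e)%:E * j e A)%E.

Lemma start_mass_gt0 : 0 < start_mass Pr Y.
Proof. by rewrite -lte_fin -(start_massE YS) -(start_event_mass a0 b0 ab YS mX XYS PX). Qed.

(** The mass of the start and the factor exp (- kappa) cancel in the conditional
    law; only the weights of the words distinguish two bridges. *)
Lemma bridge_law_mixture : exists Z : R, [/\ 0 < Z,
  balanced_sum (fun e => (weight a b e)%:E * j e setT)%E = Z%:E &
  forall A, measurable A ->
    m A = (Z^-1%:E * balanced_sum (fun e => (weight a b e)%:E * j e A))%E].
Proof.
pose c := start_mass Pr Y * expR (- kappa).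
have c0 : 0 < c by rewrite mulr_gt0 ?start_mass_gt0 ?expR_gt0.
have w0 e : 0 < weight a b e by exact: weight_gt0.
have F0 A e : (0 <= (weight a b e)%:E * j e A)%E.
  by rewrite mule_ge0// lee_fin ltW.
pose T A := balanced_sum (fun e => (weight a b e)%:E * j e A)%E.
have PE B : measurable B -> P (B `&` @bridge_event R) = (c%:E * T (@path_of R @^-1` B))%E.
  move=> mB; rewrite (bridge_decomposition a0 b0 ab YS mX XYS PX)// -balanced_sumZl ?ltW//.
  apply: eq_balanced_sum => e eb; rewrite jE//; last by exists B => //; rewrite setTI.
  by rewrite EFinM muleA.
have Pbr : P (@bridge_event R) = (c%:E * T setT)%E.
  by rewrite -[X in P X]setTI PE// preimage_setT.
have T0 A : (0 <= T A)%E.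
  by apply: nneseries_ge0 => k _ _; case: pickle_inv => //= e; case: ifP.
have Tfin : T setT \is a fin_num.
  have : (c%:E * T setT)%E \is a fin_num.
    by rewrite -Pbr fin_num_measure//; exact: measurable_bridge_event.
  have := T0 setT; case: (T setT) => [r _ _ //|_|//].
  by rewrite mulry gtr0_sg// mul1e.
have jnil : (0 < j [::] setT)%E.
  have := jE (e := [::]) (A := setT) isT measurableT; rewrite setIT.
  rewrite (jump_event_law a0 b0 ab YS) => H.
  rewrite lt0e measure_ge0 andbT; apply/eqP => j0; move: H.
  rewrite j0 mule0 => -[] /eqP; rewrite gt_eqF// divr_gt0 ?ltr0n ?fact_gt0// mulr_gt0//.
have Tpos : (0 < T setT)%E.
  apply: lt_le_trans (_ : ((weight a b [::])%:E * j [::] setT <= _)%E).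
    by rewrite mule_gt0// lte_fin.
  have [k0 k0E] : exists k0, pickle_inv k0 = Some ([::] : seq bool).
    by exists (choice.pickle ([::] : seq bool)); exact: pickleK_inv.
  rewrite /T /balanced_sum (nneseriesD1 (n := k0))//; last first.
    by move=> k _; case: pickle_inv => //= e; case: ifP.
  rewrite k0E /= leeDl//.
  by apply: nneseries_ge0 => k _ _; case: pickle_inv => //= e; case: ifP.
have TZ : T setT = (fine (T setT))%:E by rewrite fineK.
have Z0 : 0 < fine (T setT) by rewrite -lte_fin -TZ.
exists (fine (T setT)); split=> // A [B mB <-]; rewrite setTI.
rewrite [LHS](mP mB) /bridge PE// Pbr TZ -EFinM /= -/(T _) muleAC -EFinM.
by congr (_%:E * _)%E; field; rewrite !gt_eqF.
Qed.

End mixture.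

(** * Integrals against mixtures *)

Lemma dist_parts (R : realType) (p n p' n' Dp Dn D : R) :
  p <= p' + Dp -> n <= n' + Dn -> p' <= p + Dp -> n' <= n + Dn -> Dp + Dn <= D ->
  `|(p - n) - (p' - n')| <= D.
Proof. by move=> *; rewrite ler_norml; apply/andP; split; lra. Qed.

Section mixtures.
Context d (T : measurableType d) (R : realType).
Local Open Scope ereal_scope.
Implicit Types (m : {measure set T -> \bar R}) (w : seq bool -> R)
  (j : seq bool -> {measure set T -> \bar R}).

Lemma integral_mixture m j w (h : T -> \bar R) :
  (forall e, 0 <= w e)%R ->
  (forall A, measurable A -> m A = balanced_sum (fun e => (w e)%:E * j e A)) ->
  measurable_fun [set: T] h -> (forall x, 0 <= h x) ->
  \int[m]_x h x = balanced_sum (fun e => (w e)%:E * \int[j e]_x h x).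
Proof.
move=> w0 mE mh h0.
pose M k : {measure set T -> \bar R} := match pickle_inv k with
  | Some e => if balanced e then (mscale (NngNum (w0 e)) (j e) : {measure set T -> \bar R})
              else (mzero : {measure set T -> \bar R})
  | None => (mzero : {measure set T -> \bar R}) end.
rewrite (eq_measure_integral (mseries M 0)); last first.
  move=> A mA _; rewrite [LHS]mE//; apply: eq_eseriesr => k _.
  by rewrite /M; case: pickle_inv => [e|//] /=; case: ifP.
rewrite ge0_integral_measure_series//; apply: eq_eseriesr => k _.
rewrite /M; case: pickle_inv => [e|] /=; last by rewrite integral_measure_zero.
case: ifP => _; last by rewrite integral_measure_zero.
by rewrite ge0_integral_mscale.
Qed.

Lemma integral_mixture_le m1 m2 j w1 w2 (h : T -> \bar R) :
  (forall e, 0 <= w1 e)%R -> (forall e, 0 <= w2 e)%R ->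
  (forall A, measurable A -> m1 A = balanced_sum (fun e => (w1 e)%:E * j e A)) ->
  (forall A, measurable A -> m2 A = balanced_sum (fun e => (w2 e)%:E * j e A)) ->
  measurable_fun [set: T] h -> (forall x, 0 <= h x) ->
  \int[m1]_x h x <= \int[m2]_x h x +
    balanced_sum (fun e => `|w1 e - w2 e|%:E * \int[j e]_x h x).
Proof.
move=> w10 w20 m1E m2E mh h0.
have I0 e : 0 <= \int[j e]_x h x by exact: integral_ge0.
rewrite (integral_mixture w10 m1E)// (integral_mixture w20 m2E)// -balanced_sumD; last 2 first.
- by move=> e _; rewrite mule_ge0// lee_fin.
- by move=> e _; rewrite mule_ge0// lee_fin.
apply: le_balanced_sum => e _; first by rewrite mule_ge0// lee_fin.
rewrite -ge0_muleDl ?lee_fin// -EFinD.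
apply: lee_wpmul2r => //; rewrite lee_fin.
by have := ler_norm (w1 e - w2 e)%R; rewrite lerBlDl.
Qed.

(** A weighted total variation bound. The positive and negative parts of f - c
    are compared separately, term by term in the series, and the four resulting
    inequalities between finite integrals are added. *)
Lemma integral_mixture_dist (P Q : probability T R) j w1 w2 (f : T -> R) (c : R)
    (B : seq bool -> R) :
  (forall e, 0 <= w1 e)%R -> (forall e, 0 <= w2 e)%R ->
  (forall A, measurable A -> P A = balanced_sum (fun e => (w1 e)%:E * j e A)) ->
  (forall A, measurable A -> Q A = balanced_sum (fun e => (w2 e)%:E * j e A)) ->
  P.-integrable [set: T] (EFin \o f) -> Q.-integrable [set: T] (EFin \o f) ->
  (forall e, balanced e -> 0 <= B e)%R ->
  (forall e, balanced e -> j e [set x | B e < `|f x - c|]%R = 0) ->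
  `| \int[P]_x (f x)%:E - \int[Q]_x (f x)%:E | <=
    balanced_sum (fun e => (`|w1 e - w2 e| * B e)%:E * j e setT).
Proof.
move=> w10 w20 PE QE Pf Qf B0 jB.
set D := balanced_sum _.
have [->|Dfin] := eqVneq D +oo; first by rewrite leey.
have D0 : 0 <= D.
  by apply: balanced_sum_ge0 => e eb; rewrite mule_ge0// lee_fin mulr_ge0// B0.
pose g x := (f x - c)%R.
have mf : measurable_fun [set: T] f by apply/measurable_EFinP; case/integrableP : Pf.
have mg : measurable_fun [set: T] g by exact: measurable_funB.
have mG : measurable_fun [set: T] (EFin \o g) by exact/measurable_EFinP.
have shift (m : probability T R) : m.-integrable [set: T] (EFin \o f) ->
    m.-integrable [set: T] (EFin \o g) /\
    \int[m]_x (f x)%:E = \int[m]_x (g x)%:E + c%:E.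
  move=> mfi; have ci := finite_measure_integrable_cst m c measurableT.
  have gi : m.-integrable [set: T] (EFin \o g) by exact: (integrableB measurableT mfi ci).
  split=> //; have -> : \int[m]_x (g x)%:E = \int[m]_x (f x)%:E - \int[m]_x c%:E.
    by rewrite -integralB_EFin//.
  rewrite integral_cst// [X in _ - _ * X](_ : _ = 1); last exact: probability_setT.
  by rewrite mule1 subeK.
have [Pg ->] := shift P Pf; have [Qg ->] := shift Q Qf.
rewrite [X in X <= _](_ : _ = `|\int[P]_x (g x)%:E - \int[Q]_x (g x)%:E|); last first.
  have Pi := integrable_fin_num measurableT Pg.
  have Qi := integrable_fin_num measurableT Qg.
  rewrite /= in Pi Qi.
  rewrite -(fineK Pi) -(fineK Qi) -!EFinD /=.
  by congr (`|_|%:E); ring.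
have mp : measurable_fun [set: T] ((EFin \o g)^\+) by exact: measurable_funepos.
have mn : measurable_fun [set: T] ((EFin \o g)^\-) by exact: measurable_funeneg.
pose Dp := balanced_sum (fun e => `|w1 e - w2 e|%:E * \int[j e]_x (EFin \o g)^\+ x).
pose Dn := balanced_sum (fun e => `|w1 e - w2 e|%:E * \int[j e]_x (EFin \o g)^\- x).
have DD : Dp + Dn <= D.
  rewrite /Dp /Dn -balanced_sumD; last 2 first.
  - by move=> e _; rewrite mule_ge0 ?lee_fin// integral_ge0.
  - by move=> e _; rewrite mule_ge0 ?lee_fin// integral_ge0.
  apply: le_balanced_sum => e eb.
    by rewrite adde_ge0// mule_ge0 ?lee_fin// integral_ge0.
  rewrite -ge0_muleDr ?integral_ge0// EFinM -muleA; apply: lee_wpmul2l; first by rewrite lee_fin.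
  rewrite -ge0_integralD// -(integral_cst (j e) measurableT).
  apply: ae_ge0_le_integral => //.
  - by move=> x _; rewrite adde_ge0.
  - exact: emeasurable_funD.
  - by move=> x _; rewrite lee_fin B0.
  exists [set x | B e < `|f x - c|]%R; split.
  - apply: measurable_set_gt; exact: measurableT_comp.
  - exact: jB.
  move=> x /= h; rewrite ltNge; apply/negP => h'; apply: h => _.
  have := congr1 (fun k => k x) (fune_abse (EFin \o g)) => /= <-.
  by rewrite lee_fin.
have e1 := integral_mixture_le w10 w20 PE QE mp (fun x => funepos_ge0 _ x).
have e2 := integral_mixture_le w10 w20 PE QE mn (fun x => funeneg_ge0 _ x).
have e3 := integral_mixture_le w20 w10 QE PE mp (fun x => funepos_ge0 _ x).
have e4 := integral_mixture_le w20 w10 QE PE mn (fun x => funeneg_ge0 _ x).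
rewrite [X in _ <= _ + X](_ : _ = Dp) in e3; last first.
  by apply: eq_balanced_sum => e _; rewrite distrC.
rewrite [X in _ <= _ + X](_ : _ = Dn) in e4; last first.
  by apply: eq_balanced_sum => e _; rewrite distrC.
rewrite -/Dp in e1; rewrite -/Dn in e2.
have Dp0 : 0 <= Dp.
  by apply: balanced_sum_ge0 => e _; rewrite mule_ge0 ?lee_fin// integral_ge0.
have Dn0 : 0 <= Dn.
  by apply: balanced_sum_ge0 => e _; rewrite mule_ge0 ?lee_fin// integral_ge0.
have Dlt : D < +oo by rewrite ltey.
have Dpf : Dp \is a fin_num.
  rewrite (ge0_fin_numE Dp0); apply: le_lt_trans Dlt; apply: le_trans DD; exact: (leeDl Dp Dn0).
have Dnf : Dn \is a fin_num.
  rewrite (ge0_fin_numE Dn0); apply: le_lt_trans Dlt; apply: le_trans DD; exact: (leeDr Dn Dp0).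
have Df : D \is a fin_num by rewrite ge0_fin_numE.
rewrite integralE [X in _ - X]integralE.
move: e1 e2 e3 e4 DD.
rewrite -(fineK (integrable_pos_fin_num measurableT Pg)).
rewrite -(fineK (integrable_neg_fin_num measurableT Pg)).
rewrite -(fineK (integrable_pos_fin_num measurableT Qg)).
rewrite -(fineK (integrable_neg_fin_num measurableT Qg)).
rewrite -(fineK Dpf) -(fineK Dnf) -(fineK Df).
rewrite -!EFinD !lee_fin; exact: dist_parts.
Qed.

End mixtures.

(** * Weighted variation of Bessel weights *)

Section bessel.
Variable R : realType.
Implicit Types (x y z : R) (e : seq bool).

Definition bessel_term x n : R := x ^+ n / n`!%:R ^+ 2.

Definition bessel_sum x : R := limn (series (bessel_term x)).

Lemma besselI0E y : besselI0 y = bessel_sum ((y / 2) ^+ 2).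
Proof.
rewrite /besselI0 /bessel_sum; congr (limn (series _)).
by apply/funext => k; rewrite /bessel_term exprM.
Qed.

Lemma bessel_term_ge0 x n : 0 <= x -> 0 <= bessel_term x n.
Proof. by move=> x0; rewrite divr_ge0 ?exprn_ge0. Qed.

Lemma is_cvg_bessel x : 0 <= x -> cvgn (series (bessel_term x)).
Proof.
move=> x0; apply: series_le_cvg (is_cvg_series_exp_coeff x) => n.
- exact: bessel_term_ge0.
- by rewrite /exp_coeff /= divr_ge0 ?exprn_ge0.
rewrite /exp_coeff /= /bessel_term ler_wpM2l ?exprn_ge0// lef_pV2 ?posrE ?exprn_gt0 ?ltr0n ?fact_gt0//.
by rewrite expr2 ler_peMr ?ler0n// ler1n fact_gt0.
Qed.

Lemma le_bessel_sum x y : 0 <= x -> x <= y -> bessel_sum x <= bessel_sum y.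
Proof.
move=> x0 xy; have y0 := le_trans x0 xy.
apply: lim_series_le (is_cvg_bessel x0) (is_cvg_bessel y0) _ => n.
by rewrite ler_wpM2r ?invr_ge0 ?exprn_ge0// lerXn2r ?nnegrE.
Qed.

Lemma nneseries_bessel x : 0 <= x -> (\sum_(n <oo) (bessel_term x n)%:E = (bessel_sum x)%:E)%E.
Proof. by move=> x0; rewrite nneseries_EFin//; exact: is_cvg_bessel. Qed.

Lemma bessel_sum_gt0 x : 0 <= x -> 0 < bessel_sum x.
Proof.
move=> x0; apply: (@lt_le_trans _ _ 1) => //.
rewrite -lee_fin -nneseries_bessel// (@nneseries_recl _ _ (fun n => (bessel_term x n)%:E))//.
  rewrite {1}/bessel_term expr0 fact0 expr1n divr1 leeDl//.
  by apply: nneseries_ge0 => n _ _; rewrite lee_fin bessel_term_ge0.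
by move=> n _; rewrite lee_fin bessel_term_ge0.
Qed.

Definition pairs e : R := (size e)./2%:R.

Lemma balanced_sum_pow x : 0 <= x ->
  balanced_sum (fun e => (x ^+ (size e)./2 / (size e)`!%:R)%:E) = (bessel_sum x)%:E.
Proof.
move=> x0; rewrite (balanced_sum_half (G := fun n => x ^+ n)); first exact: nneseries_bessel.
by move=> n; rewrite exprn_ge0.
Qed.

(** As n ^ 2 / n! ^ 2 is 1 / (n - 1)! ^ 2, the second moment is a shifted series. *)
Lemma balanced_sum_pow2 x : 0 <= x ->
  balanced_sum (fun e => (pairs e ^+ 2 * x ^+ (size e)./2 / (size e)`!%:R)%:E) =
  (x * bessel_sum x)%:E.
Proof.
move=> x0; rewrite (balanced_sum_half (G := fun n => n%:R ^+ 2 * x ^+ n)); last first.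
  by move=> n; rewrite mulr_ge0 ?exprn_ge0.
have F0 n : (0 <= (n%:R ^+ 2 * x ^+ n / n`!%:R ^+ 2)%:E)%E.
  by rewrite lee_fin divr_ge0 ?mulr_ge0 ?exprn_ge0.
rewrite nneseries_recl// expr0n /= !mul0r add0e -(nneseries_addn 1)//.
rewrite EFinM -nneseries_bessel// -nneseriesZl; last first.
  by move=> n _; rewrite lee_fin bessel_term_ge0.
apply: eq_eseriesr => n _; rewrite addn1 -EFinM; congr EFin.
rewrite /bessel_term (exprS x n) factS natrM.
have n0 : n.+1%:R != 0 :> R by rewrite pnatr_eq0.
have f0 : n`!%:R != 0 :> R by rewrite pnatr_eq0 -lt0n fact_gt0.
by field; rewrite f0 nat1r n0.
Qed.

(** The Cauchy-Schwarz bound on the first moment, by way of 2 n <= t + n^2 / t. *)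
Lemma balanced_sum_pow1 x : 0 < x ->
  (balanced_sum (fun e => (pairs e * x ^+ (size e)./2 / (size e)`!%:R)%:E) <=
  (Num.sqrt x * bessel_sum x)%:E)%E.
Proof.
move=> x0; have x0' := ltW x0; set t := Num.sqrt x.
have t0 : 0 < t by rewrite sqrtr_gt0.
have tt : t ^+ 2 = x by rewrite sqr_sqrtr.
have -> : (t * bessel_sum x)%:E =
    ((t / 2)%:E * (bessel_sum x)%:E + ((2 * t)^-1)%:E * (x * bessel_sum x)%:E)%E.
  by rewrite -!EFinM -EFinD; congr EFin; rewrite -[X in _ + _ * (X * _)]tt; field; rewrite gt_eqF.
rewrite -balanced_sum_pow2// -balanced_sum_pow//.
have P0 e : 0 <= x ^+ (size e)./2 / (size e)`!%:R by rewrite divr_ge0 ?exprn_ge0.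
rewrite -!balanced_sumZl; last 4 first.
- by rewrite invr_ge0 mulr_ge0// ltW.
- by move=> e _; rewrite lee_fin -mulrA mulr_ge0 ?exprn_ge0.
- by rewrite divr_ge0// ltW.
- by move=> e _; rewrite lee_fin.
rewrite -balanced_sumD; last 2 first.
- by move=> e _; rewrite -EFinM lee_fin mulr_ge0// divr_ge0// ltW.
- by move=> e _; rewrite -EFinM lee_fin -mulrA !mulr_ge0 ?exprn_ge0// invr_ge0 mulr_ge0// ltW.
apply: le_balanced_sum => e _; first by rewrite lee_fin -mulrA mulr_ge0 ?ler0n.
rewrite -!EFinM -EFinD lee_fin -!mulrA.
set p := x ^+ _ * _; set n := pairs e.
have p0 : 0 <= p := P0 e.
rewrite [leRHS](_ : _ = ((t / 2) + (2 * t)^-1 * n ^+ 2) * p); last by ring.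
apply: ler_wpM2r => //.
rewrite -subr_ge0 [X in 0 <= X](_ : _ = (t - n) ^+ 2 / (2 * t)); last by field; rewrite gt_eqF.
by rewrite divr_ge0 ?sqr_ge0// mulr_ge0// ltW.
Qed.

(** The difference u / U - v / V of normalised weights splits into (u - v) / U and
    v (V - U) / (U V). After multiplication by the number of pairs the first one
    is controlled by the second moment of the weights z ^ n, the second one by a
    product of two first moments. *)
Lemma weighted_variation (u : seq bool -> R) (y z delta U : R) :
  (forall e, 0 <= u e) -> 0 < y -> y <= z -> 0 <= delta -> 0 < U ->
  balanced_sum (fun e => (u e / (size e)`!%:R)%:E) = U%:E ->
  (forall e, balanced e ->
    `|u e - y ^+ (size e)./2| <= delta * (pairs e * z ^+ (size e)./2)) ->
  (balanced_sum (fun e => (`|u e / U - y ^+ (size e)./2 / bessel_sum y|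
     * pairs e / (size e)`!%:R)%:E) <= (2 * delta * z * (bessel_sum z / U))%:E)%E.
Proof.
move=> u0 y0 yz d0 U0 uU uy.
have z0 := lt_le_trans y0 yz.
have Zy := bessel_sum_gt0 (ltW y0); have Zz := bessel_sum_gt0 (ltW z0).
have sz : 0 <= Num.sqrt z by exact: sqrtr_ge0.
have f0 e : 0 <= (size e)`!%:R^-1 :> R by rewrite invr_ge0.
have pz e : 0 <= pairs e * z ^+ (size e)./2 / (size e)`!%:R.
  by rewrite !mulr_ge0 ?exprn_ge0 ?ler0n// ltW.
have py e : 0 <= pairs e * y ^+ (size e)./2 / (size e)`!%:R.
  by rewrite !mulr_ge0 ?exprn_ge0 ?ler0n// ltW.
have yy e : 0 <= y ^+ (size e)./2 / (size e)`!%:R.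
  by rewrite !mulr_ge0 ?exprn_ge0 ?ler0n// ltW.
have uu e : 0 <= u e / (size e)`!%:R by rewrite mulr_ge0.
set K := delta * (Num.sqrt z * bessel_sum z).
have K0 : 0 <= K by rewrite !mulr_ge0// ltW.
have sK : (balanced_sum (fun e => delta%:E *
     (pairs e * z ^+ (size e)./2 / (size e)`!%:R)%:E)%E <= K%:E)%E.
  rewrite balanced_sumZl//; last by move=> e _; rewrite lee_fin.
  rewrite /K EFinM; apply: lee_wpmul2l; first by rewrite lee_fin.
  exact: balanced_sum_pow1.
have uyE e : balanced e -> `|u e / (size e)`!%:R - y ^+ (size e)./2 / (size e)`!%:R|
     <= delta * (pairs e * z ^+ (size e)./2 / (size e)`!%:R).
  move=> eb; rewrite -mulrBl normrM (ger0_norm (f0 e)) !mulrA ler_wpM2r// -mulrA.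
  exact: uy.
have UK : `|bessel_sum y - U| <= K.
  rewrite ler_norml; apply/andP; split.
    rewrite lerBrDl lerBlDr -lee_fin EFinD -uU -(balanced_sum_pow (ltW y0)).
    apply: le_trans (_ : (balanced_sum (fun e => (y ^+ (size e)./2 / (size e)`!%:R)%:E) +
       balanced_sum (fun e => delta%:E * (pairs e * z ^+ (size e)./2 / (size e)`!%:R)%:E) <= _)%E).
      rewrite -balanced_sumD => [||e _]; last by rewrite mule_ge0// lee_fin.
        apply: le_balanced_sum => e eb; first by rewrite lee_fin.
        rewrite -EFinM -EFinD lee_fin.
        by have := uyE e eb; rewrite ler_norml => /andP[_]; rewrite lerBlDl.
      by move=> e _; rewrite lee_fin.
    by rewrite leeD2l.
  rewrite lerBlDl -lee_fin EFinD -uU -(balanced_sum_pow (ltW y0)).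
  apply: le_trans (_ : (balanced_sum (fun e => (u e / (size e)`!%:R)%:E) +
     balanced_sum (fun e => delta%:E * (pairs e * z ^+ (size e)./2 / (size e)`!%:R)%:E) <= _)%E).
    rewrite -balanced_sumD => [||e _]; last by rewrite mule_ge0// lee_fin.
      apply: le_balanced_sum => e eb; first by rewrite lee_fin.
      rewrite -EFinM -EFinD lee_fin.
      have := uyE e eb; rewrite ler_norml => /andP[h _]; lra.
    by move=> e _; rewrite lee_fin.
  by rewrite leeD2l.
pose c1 := delta / U; pose c2 := K / (U * bessel_sum y).
have c10 : 0 <= c1 by rewrite divr_ge0// ltW.
have c20 : 0 <= c2 by rewrite divr_ge0// mulr_ge0// ltW.
have pz2 e : 0 <= pairs e ^+ 2 * z ^+ (size e)./2 / (size e)`!%:R.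
  by rewrite !mulr_ge0 ?exprn_ge0 ?ler0n// ltW.
apply: (@le_trans _ _ (c1%:E * (z * bessel_sum z)%:E + c2%:E * (Num.sqrt y * bessel_sum y)%:E)%E).
  apply: (@le_trans _ _ (balanced_sum (fun e =>
      c1%:E * (pairs e ^+ 2 * z ^+ (size e)./2 / (size e)`!%:R)%:E +
      c2%:E * (pairs e * y ^+ (size e)./2 / (size e)`!%:R)%:E)%E)).
    apply: le_balanced_sum => e eb.
      by rewrite lee_fin mulr_ge0// mulr_ge0// ler0n.
    rewrite -!EFinM -EFinD lee_fin !mulrA -mulrDl ler_wpM2r//.
    have n0 : 0 <= pairs e by exact: ler0n.
    set n := pairs e in n0 *; set Y := y ^+ _; set V := z ^+ _.
    have Y0 : 0 <= Y by rewrite exprn_ge0// ltW.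
    have h1 : `|u e / U - Y / bessel_sum y| <=
        `|u e - Y| / U + Y * `|bessel_sum y - U| / (U * bessel_sum y).
      rewrite [X in `|X| <= _](_ : _ = (u e - Y) / U + Y * (bessel_sum y - U) / (U * bessel_sum y)).
        apply: le_trans (ler_normD _ _) _.
        rewrite !normrM !normfV (gtr0_norm U0) normrM (gtr0_norm U0) (gtr0_norm Zy).
        by rewrite (ger0_norm Y0).
      by field; rewrite !gt_eqF.
    have h2 : `|u e - Y| / U <= c1 * n * V.
      rewrite /c1 [leRHS](_ : _ = delta * (n * V) / U); last by ring.
      by rewrite ler_pM2r ?invr_gt0//; exact: uy.
    have h3 : Y * `|bessel_sum y - U| / (U * bessel_sum y) <= c2 * Y.
      rewrite /c2 [leRHS](_ : _ = Y * K / (U * bessel_sum y)); last by ring.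
      by rewrite ler_pM2r ?invr_gt0 ?mulr_gt0// ler_wpM2l.
    rewrite [leRHS](_ : _ = (c1 * n * V + c2 * Y) * n); last by ring.
    by rewrite ler_wpM2r//; apply: le_trans h1 _; rewrite lerD.
  rewrite balanced_sumD; last 2 first.
  - by move=> e _; rewrite -EFinM lee_fin mulr_ge0.
  - by move=> e _; rewrite -EFinM lee_fin mulr_ge0.
  rewrite balanced_sumZl//; last by move=> e _; rewrite lee_fin.
  rewrite balanced_sumZl//; last by move=> e _; rewrite lee_fin.
  rewrite balanced_sum_pow2 ?(ltW z0)//; apply: leeD => //.
  by apply: lee_wpmul2l; [rewrite lee_fin|exact: balanced_sum_pow1].
rewrite -!EFinM -EFinD lee_fin.
have sy : Num.sqrt y <= Num.sqrt z by rewrite ler_wsqrtr.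
have zz : Num.sqrt z * Num.sqrt z = z by rewrite -expr2 sqr_sqrtr// ltW.
rewrite [leLHS](_ : _ = delta * (bessel_sum z / U) * (z + Num.sqrt z * Num.sqrt y)); last first.
  by rewrite /c1 /c2 /K; field; rewrite !gt_eqF.
rewrite [leRHS](_ : _ = delta * (bessel_sum z / U) * (z + z)); last by ring.
apply: ler_wpM2l; first by rewrite mulr_ge0// divr_ge0// ltW.
by rewrite lerD2l -[leRHS]zz ler_wpM2l.
Qed.

End bessel.

(** * The Wasserstein bound *)

Section interpolation.
Variable R : realType.

Lemma onemX_le (x : R) n : 0 <= x -> x <= 1 -> 1 - x ^+ n <= (1 - x) * n%:R.
Proof.
move=> x0 x1; elim: n => [|n IH]; first by rewrite expr0 subrr mulr0.
have xn : x ^+ n <= 1 by rewrite exprn_ile1.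
rewrite exprSr -natr1; have := exprn_ge0 n x0; nra.
Qed.

(** For a weight between (z x ^ 2) ^ n and z ^ n, the geometric mean z x makes the
    upper deviation the larger one; it is bounded by the Bernoulli inequality. *)
Lemma geometric_mean_dist (x z w : R) n : 0 <= x -> x <= 1 -> 0 <= z ->
  (z * x ^+ 2) ^+ n <= w <= z ^+ n ->
  `|w - (z * x) ^+ n| <= (1 - x) * (n%:R * z ^+ n).
Proof.
move=> x0 x1 z0; rewrite !exprMn => /andP[h1 h2].
have zn := exprn_ge0 n z0; have xn := exprn_ge0 n x0.
have xn1 : x ^+ n <= 1 by rewrite exprn_ile1.
have b : z ^+ n * (1 - x ^+ n) <= (1 - x) * (n%:R * z ^+ n).
  rewrite mulrA [leRHS]mulrC; apply: ler_wpM2l => //; exact: onemX_le.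
apply: le_trans b; rewrite ler_norml; apply/andP; split; last by nra.
have : 0 <= z ^+ n * (1 - x ^+ n) * (1 - x ^+ n) by rewrite !mulr_ge0// subr_ge0.
move: h1; set Zn := z ^+ n; set Xn := x ^+ n => h1 h3; nra.
Qed.

(** [weighted_variation] is used with the smaller of lam and 1 in the place of y,
    and the other in the place of z. *)
Lemma bessel_variation (lam : R) : 0 < lam ->
  (balanced_sum (fun e => (`|lam ^+ (size e)./2 / bessel_sum lam - 1 / bessel_sum 1|
     * pairs R e / (size e)`!%:R)%:E) <= (2 * `|1 - lam|)%:E)%E.
Proof.
move=> l0; have l0' := ltW l0.
have s0 := bessel_sum_gt0 (ltW l0); have s1 := bessel_sum_gt0 (ler01 : 0 <= (1 : R)).
have [l1|/ltW l1] := leP 1 lam.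
  have := @weighted_variation R (fun e => lam ^+ (size e)./2) 1 lam (1 - lam^-1) (bessel_sum lam).
  move=> /(_ _ ltr01 l1 _ s0 (balanced_sum_pow l0')) H.
  apply: (@le_trans _ _ (2 * (1 - lam^-1) * lam * (bessel_sum lam / bessel_sum lam))%:E).
    apply: le_trans (H _ _ _).
    - by apply: le_balanced_sum => e _; rewrite ?expr1n// lee_fin mulr_ge0// mulr_ge0 ?ler0n.
    - by move=> e; rewrite exprn_ge0.
    - by rewrite subr_ge0 invf_le1.
    move=> e _; rewrite expr1n.
    have il : lam^-1 <= 1 by rewrite invf_le1.
    have := @geometric_mean_dist lam^-1 lam (lam ^+ (size e)./2) (size e)./2.
    rewrite mulfV ?gt_eqF// expr1n; apply => //; first by rewrite invr_ge0.
    rewrite lexx andbT; apply: lerXn2r; rewrite ?nnegrE//.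
      by rewrite mulr_ge0// exprn_ge0// invr_ge0.
    by rewrite ler_piMr// exprn_ile1// invr_ge0.
  rewrite lee_fin divff ?gt_eqF// mulr1 ler0_norm ?subr_le0//.
  by rewrite le_eqVlt; apply/orP; left; apply/eqP; field; rewrite gt_eqF.
have := @weighted_variation R (fun=> 1) lam 1 (1 - lam) (bessel_sum 1).
move=> /(_ _ l0 l1 _ s1 _) H.
apply: (@le_trans _ _ (2 * (1 - lam) * 1 * (bessel_sum 1 / bessel_sum 1))%:E).
  apply: le_trans (H _ _ _ _).
  - apply: le_balanced_sum => e _; first by rewrite lee_fin mulr_ge0// mulr_ge0 ?ler0n.
    by rewrite distrC.
  - by move=> e; exact: ler01.
  - by rewrite subr_ge0.
  - rewrite -(balanced_sum_pow (ler01 : 0 <= (1 : R))).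
    by apply: eq_balanced_sum => e _; rewrite expr1n.
  move=> e _; rewrite expr1n.
  have := @geometric_mean_dist lam 1 1 (size e)./2; rewrite !mul1r expr1n lexx andbT; apply => //.
  by rewrite exprn_ile1 ?exprn_ge0// exprn_ile1.
rewrite lee_fin divff ?gt_eqF// !mulr1 ger0_norm// subr_ge0//.
Qed.

(** The Bessel quotient A is at least 1, hence (1 - x) A <= A - x. *)
Lemma variation_arith (mu x lam A W B D : R) :
  0 < mu -> 0 <= x -> x <= 1 -> lam = mu * x -> W <= A -> 1 <= A -> A <= B -> 0 <= D ->
  2 * (1 - x) * mu * W + 2 * D <= 9 * (mu * B - lam + D).
Proof.
move=> mu0 x0 x1 -> WA A1 AB D0.
have h0 : 0 <= (1 - x) * mu by rewrite mulr_ge0 ?subr_ge0// ltW.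
have h1 : 0 <= mu * x * (A - 1) by rewrite !mulr_ge0 ?subr_ge0// ltW.
have h2 := ler_wpM2l h0 WA.
have h3 : mu * A <= mu * B by rewrite ler_pM2l.
have h4 : 0 <= mu * (A - x) by rewrite mulr_ge0 ?(ltW mu0)// subr_ge0 (le_trans x1).
nra.
Qed.

End interpolation.

Theorem theorem3p27 (R : realType) (a b : int -> R) (kappa mu nu : R)
    (a_gt0 : forall j, 0 < a j) (b_gt0 : forall j, 0 < b j)
    (kappa_gt0 : 0 < kappa) (nu_gt0 : 0 < nu) (nu_le_mu : nu <= mu)
    (ab_kappa : forall j, a j + b j = kappa)
    (ab_bound : forall j, nu <= a j * b (j + 1) <= mu)
    (Pab P11 : probability (cadlag R) R)
    (Pab_walk : walk_law a b Pab)
    (P11_walk : walk_law (fun=> 1) (fun=> 1) P11)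
    (Pab_start : (0 < Pab (@start_event R))%E)
    (P11_start : (0 < P11 (@start_event R))%E)
    (Pab00 P1100 : probability (config R) R)
    (Pab00_bridge : is_bridge_law Pab Pab00)
    (P1100_bridge : is_bridge_law P11 P1100) :
  (W1 Pab00 P1100 <=
   (9 * (mu * (besselI0 (2 * mu / Num.sqrt nu) / besselI0 (2 * Num.sqrt nu))
         - Num.sqrt (mu * nu) + `|1 - Num.sqrt (mu * nu)|))%:E)%E.
Proof.
have mu_gt0 := lt_le_trans nu_gt0 nu_le_mu.
have [disp1 [T1 [Pr1 [Y1 [S1 [X1 [YS1 mX1 XY1 PX1]]]]]]] := Pab_walk.
have [disp2 [T2 [Pr2 [Y2 [S2 [X2 [YS2 mX2 XY2 PX2]]]]]]] := P11_walk.
have one0 (j : int) : (0 : R) < (fun=> 1) j by exact: ltr01.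
have one2 (j : int) : (fun=> 1) j + (fun=> 1) j = 2 :> R by [].
have q1 := start_mass_gt0 a_gt0 b_gt0 ab_kappa YS1 mX1 XY1 PX1 Pab_start.
have q2 := start_mass_gt0 one0 one0 one2 YS2 mX2 XY2 PX2 P11_start.
pose c := start_mass Pr2 Y2 * expR (- 2).
have c0 : 0 < c by rewrite mulr_gt0 ?expR_gt0.
(* The reference measures are taken from the simple walk. *)
have jex e : exists m : {measure set config R -> \bar R}, balanced e -> forall A,
    m A = (c^-1%:E * Pr2 (jump_event Y2 S2 e `&` jump_config S2 e @^-1` A))%E.
  have [eb|eb] := boolP (balanced e); last by exists mzero.
  have ci : 0 <= c^-1 by rewrite invr_ge0 ltW.
  have [m mE] := scaled_pushforward Pr2 (measurable_jump_event YS2 e)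
    (measurable_jump_config YS2 eb) ci.
  by exists m => _; exact: mE.
have [j jP] := boolp.choice jex.
have jE1 e A : balanced e -> measurable A ->
    Pr1 (jump_event Y1 S1 e `&` jump_config S1 e @^-1` A) =
    ((start_mass Pr1 Y1 * expR (- kappa) * weight a b e)%:E * j e A)%E.
  move=> eb mA; rewrite jP// muleCA.
  have := jump_event_proportional a_gt0 b_gt0 ab_kappa YS1 one0 one0 one2 YS2 eb mA.
  by rewrite weight1 mulr1 -/c => <-; rewrite muleA -EFinM mulVf ?gt_eqF// mul1e.
have jE2 e A : balanced e -> measurable A ->
    Pr2 (jump_event Y2 S2 e `&` jump_config S2 e @^-1` A) =
    ((start_mass Pr2 Y2 * expR (- 2) * weight (fun=> 1) (fun=> 1) e)%:E * j e A)%E.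
  move=> eb mA; rewrite jP// weight1 mulr1 -/c.
  by rewrite muleA -EFinM mulfV ?gt_eqF// mul1e.
have jT e : balanced e -> j e setT = ((size e)`!%:R^-1)%:E.
  move=> eb; rewrite jP// preimage_setT setIT.
  rewrite (jump_event_law one0 one0 one2 YS2) weight1 mulr1 -/c -EFinM; congr EFin.
  by rewrite mulrA mulVf ?gt_eqF// mul1r.
have [W [W0 WE Pab00E]] := bridge_law_mixture a_gt0 b_gt0 ab_kappa YS1 mX1 XY1 PX1 Pab_start
  Pab00_bridge jE1.
have [Z [Z0 ZE P1100E]] := bridge_law_mixture one0 one0 one2 YS2 mX2 XY2 PX2 P11_start
  P1100_bridge jE2.
have w0 e : 0 < weight a b e by exact: weight_gt0.
have {}WE : balanced_sum (fun e => (weight a b e / (size e)`!%:R)%:E) = W%:E.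
  by rewrite -WE; apply: eq_balanced_sum => e eb; rewrite jT.
have {}ZE : Z = bessel_sum 1.
  apply/EFin_inj; rewrite -ZE -balanced_sum_pow//; apply: eq_balanced_sum => e eb.
  by rewrite jT// weight1 expr1n.
have mixE (w : seq bool -> R) (U : R) A : 0 < U -> (forall e, 0 <= w e) ->
    (U^-1%:E * balanced_sum (fun e => (w e)%:E * j e A))%E =
    balanced_sum (fun e => (w e / U)%:E * j e A)%E.
  move=> U0 w00; rewrite -balanced_sumZl ?invr_ge0 ?ltW//; last first.
    by move=> e _; rewrite mule_ge0// lee_fin.
  by apply: eq_balanced_sum => e _; rewrite muleA -EFinM mulrC.
(* The weights lam ^ n interpolate between those of the two bridges. *)
pose lam := Num.sqrt (mu * nu).
have lam0 : 0 < lam by rewrite sqrtr_gt0 mulr_gt0.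
pose x := lam / mu.
have x0 : 0 <= x by rewrite divr_ge0// ltW.
have lamE : lam = mu * x by rewrite /x mulrCA mulfV ?gt_eqF// mulr1.
have lam2 : lam ^+ 2 = mu * nu by rewrite sqr_sqrtr// mulr_ge0// ltW.
have nuE : nu = mu * x ^+ 2.
  by rewrite /x expr_div_n lam2; field; rewrite gt_eqF.
have x1 : x <= 1.
  rewrite -(ler_pM2l mu_gt0) mulr1 -lamE -(@ler_pXn2r _ 2) ?nnegrE ?(ltW mu_gt0) ?(ltW lam0)// lam2.
  by rewrite -[leRHS]/(mu * mu) ler_pM2l.
have wn e : balanced e -> nu ^+ (size e)./2 <= weight a b e <= mu ^+ (size e)./2.
  exact: weight_bounds_balanced.
have WN : bessel_sum nu <= W.
  rewrite -lee_fin -WE -balanced_sum_pow ?(ltW nu_gt0)//; apply: le_balanced_sum => e eb.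
    by rewrite lee_fin divr_ge0// exprn_ge0// ltW.
  by rewrite lee_fin ler_pM2r ?invr_gt0 ?ltr0n ?fact_gt0//; have /andP[] := wn e eb.
have V1 : (balanced_sum (fun e => (`|weight a b e / W - lam ^+ (size e)./2 / bessel_sum lam|
    * pairs R e / (size e)`!%:R)%:E) <= (2 * (1 - x) * mu * (bessel_sum mu / W))%:E)%E.
  apply: weighted_variation => //.
  - by move=> e; exact: ltW.
  - by rewrite lamE ler_piMr// ltW.
  - by rewrite subr_ge0.
  move=> e eb; rewrite lamE; apply: geometric_mean_dist => //; first exact: ltW.
  by rewrite -nuE; exact: wn.
have V2 := bessel_variation lam0.
apply: ge_ereal_sup => _ [f [fl fP fQ] <-].
apply: le_trans (@integral_mixture_dist _ _ R Pab00 P1100 j (fun e => weight a b e / W)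
  (fun e => 1 / Z) f (f (empty_config R)) (pairs R) _ _ _ _ fP fQ _ _) _.
- by move=> e; rewrite divr_ge0// ltW.
- by move=> e; rewrite divr_ge0// ltW.
- by move=> A mA; rewrite -mixE//; [exact: Pab00E|move=> e; exact: ltW].
- move=> A mA; rewrite -(mixE (fun=> 1))//; apply: (etrans (P1100E A mA)).
  by congr (_ * _)%E; apply: eq_balanced_sum => e _; rewrite weight1.
- by move=> e _; exact: ler0n.
- move=> e eb; rewrite jP// (_ : _ @^-1` _ = set0) ?setI0 ?measure0 ?mule0//.
  apply/seteqP; split=> w //=; rewrite ltNge => /negP; apply.
  exact: Lip1_config_of.
apply: le_trans (_ : ((2 * (1 - x) * mu * (bessel_sum mu / W))%:E + (2 * `|1 - lam|)%:E <= _)%E).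
  apply: le_trans (leeD V1 V2).
  rewrite -balanced_sumD; last 2 first.
  - by move=> e _; rewrite lee_fin !mulr_ge0 ?ler0n.
  - by move=> e _; rewrite lee_fin !mulr_ge0 ?ler0n.
  apply: le_balanced_sum => e eb; rewrite jT//.
    by rewrite -EFinM lee_fin !mulr_ge0 ?ler0n ?invr_ge0.
  rewrite -EFinM -EFinD lee_fin -!mulrDl ler_wpM2r ?invr_ge0//.
  rewrite ler_wpM2r ?ler0n// ZE.
  rewrite [X in `|X| <= _](_ : _ = (weight a b e / W - lam ^+ (size e)./2 / bessel_sum lam) +
    (lam ^+ (size e)./2 / bessel_sum lam - 1 / bessel_sum 1)); last by ring.
  exact: ler_normD.
rewrite -EFinD lee_fin -/lam !besselI0E.
have -> : (2 * Num.sqrt nu / 2) ^+ 2 = nu.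
  by rewrite mulrAC mulfV// mul1r sqr_sqrtr// ltW.
set M := (2 * mu / Num.sqrt nu / 2) ^+ 2.
have ME : M = mu * (mu / nu).
  have sn : Num.sqrt nu != 0 by rewrite gt_eqF// sqrtr_gt0.
  rewrite /M -[in RHS](@sqr_sqrtr _ nu) ?ltW//; field.
  by rewrite sn.
have muM : mu <= M by rewrite ME ler_peMr ?(ltW mu_gt0)// ler_pdivlMr// mul1r.
have AM := le_bessel_sum (ltW mu_gt0) muM.
have NA := le_bessel_sum (ltW nu_gt0) nu_le_mu.
have N0 := bessel_sum_gt0 (ltW nu_gt0).
have A0 := lt_le_trans N0 NA.
have r1 : bessel_sum mu / W <= bessel_sum mu / bessel_sum nu.
  by rewrite ler_pM2l// lef_pV2.
have r2 : 1 <= bessel_sum mu / bessel_sum nu by rewrite ler_pdivlMr// mul1r.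
have r3 : bessel_sum mu / bessel_sum nu <= bessel_sum M / bessel_sum nu.
  by rewrite ler_pM2r ?invr_gt0.
exact: (variation_arith mu_gt0 x0 x1 lamE r1 r2 r3 (normr_ge0 _)).
Qed.
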